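(* Let $a$ be a complex number with $\operatorname{Re}a>0$. For every $n\ge0$, the optimal degree $n$ polynomial approximant to $1/f$ in $D_0$, where $f(z)=(1-z)^a$, is given by $$p_n(z)=\sum_{k=0}^n\left(\binom{a+k-1}{k}\frac{B(n+a+1,\overline a)}{B(n-k+1,\overline a)}\right)z^k,$$ where $B(x,y)$ is the standard Euler beta function.
   Context: $D_0=H^2$ is the Hardy space of functions $g(z)=\sum_{n\ge0}a_nz^n$ analytic in the open unit disk with $\|g\|^2=\sum|a_n|^2<\infty$. The power $(1-z)^a$ is the principal branch, equal to $1$ at $z=0$. The optimal polynomial approximant of degree $n$ for $f$ is the unique polynomial $p_n$ of degree at most $n$ minimizing $\|pf-1\|$ among all polynomials $p$ of degree at most $n$. $B(x,y)=\Gamma(x)\Gamma(y)/\Gamma(x+y)$ and $\binom{a+k-1}{k}=\frac{\Gamma(a+k)}{\Gamma(a)\,k!}$. *)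

(* Defs.v *)
From Stdlib Require Export Reals Factorial ClassicalEpsilon.
From Coquelicot Require Export Coquelicot.

Open Scope C_scope.

Definition Cexp (z : C) : C :=
  RtoC (exp (Re z)) * (cos (Im z), sin (Im z)).

(** Principal argument of [w <> 0], with values in (-PI, PI]. *)
Definition Carg (w : C) : R :=
  if Rle_dec 0 (Im w) then acos (Re w / Cmod w)
  else (- acos (Re w / Cmod w))%R.

Definition Clog (w : C) : C := (ln (Cmod w), Carg w).

(** Principal branch of [w ^ s], for [w <> 0]. *)
Definition Cpower (w s : C) : C := Cexp (s * Clog w).

(** Euler's integral of t ^ (z-1) * exp (-t) over (0, +oo). It converges for
    [0 < Re z]; elsewhere the value of [Cgamma] carries no meaning. *)
Definition Cgamma (z : C) : C :=
  RInt_gen (V := C_R_CompleteNormedModule)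
    (fun t : R => Cpower (RtoC t) (z - 1) * RtoC (exp (- t)))
    (at_right 0) (Rbar_locally p_infty).

Definition Cbeta (x y : C) : C := Cgamma x * Cgamma y / Cgamma (x + y).

(** The generalized binomial coefficient "a + k - 1 choose k". *)
Definition Cbinom_rising (a : C) (k : nat) : C :=
  Cgamma (a + INR k) / (Cgamma a * INR (fact k)).

(** Elements of H^2 are represented by functions on [C] of which only the values
    in the open unit disk matter. *)
Definition power_series_on_disk (g : C -> C) (c : nat -> C) : Prop :=
  forall z : C, (Cmod z < 1)%R ->
    is_pseries (K := C_AbsRing) (V := C_NormedModule) c z (g z).

Definition in_H2 (g : C -> C) : Prop :=
  exists c : nat -> C,
    power_series_on_disk g c /\ ex_series (fun k => (Cmod (c k) ^ 2)%R).

(** The coefficients of the expansion of [g] at 0, arbitrary if [g] has none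
    on the unit disk. *)
Definition taylor_coef (g : C -> C) : nat -> C :=
  epsilon (inhabits (fun _ => RtoC 0)) (power_series_on_disk g).

(** Meaningful only for [g] satisfying [in_H2]. *)
Definition H2_norm (g : C -> C) : R :=
  sqrt (Series (fun k => (Cmod (taylor_coef g k) ^ 2)%R)).

Definition polynomial_deg_le (n : nat) (p : C -> C) : Prop :=
  exists c : nat -> C, forall z : C, p z = sum_n (fun k => c k * z ^ k) n.

Definition minimizes_H2 (n : nat) (f p : C -> C) : Prop :=
  polynomial_deg_le n p /\
  forall q : C -> C, polynomial_deg_le n q ->
    (H2_norm (fun z => p z * f z - 1)%C <= H2_norm (fun z => q z * f z - 1)%C)%R.

(** [in_H2 f] guarantees that every [q f - 1] with [q] a polynomial lies in H^2,
    so that the norms compared in [minimizes_H2] are genuine. *)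
Definition optimal_approximant (n : nat) (f p : C -> C) : Prop :=
  in_H2 f /\ unique (minimizes_H2 n f) p.

(* Main.v *)
Require Import Defs.
From Stdlib Require Import Arith Lra Lia Psatz FunctionalExtensionality.

(** The optimal approximant [p] is determined by the normal equations [<p f - 1, z^k f> = 0],
    [0 <= k <= n]. The coefficients of [f] satisfy [(k + 1) f_(k+1) = (k - a) f_k], and summing a
    telescoping combination of them shows that the Gram entries [g_m = <z^m f, f>] satisfy
    [(a + m + 1) g_(m+1) = (m - conj a) g_m]. Hence, up to sign and a constant, the claimed
    coefficient times a Gram entry is [1 / (j! (n - j)!)] times a polynomial in [j] of degree
    [n - 1], for [k >= 1], and the normal equations say that its [n]-th finite difference vanishes;
    for [k = 0] the polynomial is divided by [a + j] and the difference is explicit.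
    The remaining normalisation is [|f|^2 Gamma(a+1) Gamma(conj a + 1) = Gamma(a + conj a + 1)],
    an instance of Gauss's summation formula: raising the third parameter of the hypergeometric
    series from 1 to infinity by the contiguous relation reduces it to
    [Gamma(s + N + 1) ~ N! N^s], which also shows that [Gamma] has no zero in [Re s > 0]. *)

(** [Cgamma] is only Euler's integral, so nothing about it is available in advance, and this
    integral diverges at -a. The coefficients of f are therefore given by their recurrence, and what
    is proved about Gamma rests on three facts: the functional equation, the value at 1 and the
    growth at infinity. No Beta integral appears; [Cbeta] is a quotient of Gammas that the
    functional equation turns into rising factorials. Only the normal equation for k = 0 has a
    nonzero right-hand side, since <1, z^k f> is the conjugate of the constant coefficient of z^k f.
    The equations for k >= 1 are homogeneous and do not see a constant factor; the one for k = 0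
    determines it, and this is where |f|^2 enters. The telescoping sums over the coefficients leave
    no boundary term at infinity because k |f_k| stays bounded and f_k tends to 0. [taylor_coef] is
    an arbitrary choice among expansions, so the norm can be computed only after uniqueness of power
    series. Since [unique] compares functions on all of [C], uniqueness of the minimiser has to come
    from the coefficients of the polynomial. *)

(** * Improper integrals, by components and by domination *)

Lemma is_RInt_gen_fst (Fa Fb : (R -> Prop) -> Prop) (f : R -> C) (l : C) :
  is_RInt_gen (V := C_R_NormedModule) f Fa Fb l ->
  is_RInt_gen (V := R_NormedModule) (fun t => fst (f t)) Fa Fb (fst l).
Proof.
  intros H P [eps HP].
  destruct (H (fun y => P (fst y))) as [Q R' HQ HR Hex].
  - exists eps. intros y [Hy _]. apply HP, Hy.
  - exists Q R'; auto. intros x y Qx Ry.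
    destruct (Hex x y Qx Ry) as [y' [H1 H2]].
    exists (fst y'); split; auto.
    exact (is_RInt_fct_extend_fst (U := R_NormedModule) (V := R_NormedModule) f _ _ y' H1).
Qed.

Lemma is_RInt_gen_snd (Fa Fb : (R -> Prop) -> Prop) (f : R -> C) (l : C) :
  is_RInt_gen (V := C_R_NormedModule) f Fa Fb l ->
  is_RInt_gen (V := R_NormedModule) (fun t => snd (f t)) Fa Fb (snd l).
Proof.
  intros H P [eps HP].
  destruct (H (fun y => P (snd y))) as [Q R' HQ HR Hex].
  - exists eps. intros y [_ Hy]. apply HP, Hy.
  - exists Q R'; auto. intros x y Qx Ry.
    destruct (Hex x y Qx Ry) as [y' [H1 H2]].
    exists (snd y'); split; auto.
    exact (is_RInt_fct_extend_snd (U := R_NormedModule) (V := R_NormedModule) f _ _ y' H1).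
Qed.

Lemma is_RInt_gen_pair (Fa Fb : (R -> Prop) -> Prop) (FFa : Filter Fa) (FFb : Filter Fb)
    (f : R -> C) (l1 l2 : R) :
  is_RInt_gen (V := R_NormedModule) (fun t => fst (f t)) Fa Fb l1 ->
  is_RInt_gen (V := R_NormedModule) (fun t => snd (f t)) Fa Fb l2 ->
  is_RInt_gen (V := C_R_NormedModule) f Fa Fb (l1, l2).
Proof.
  intros H1 H2 P [eps HP].
  assert (K : filter_prod Fa Fb (fun ab =>
     (exists y, is_RInt (V := R_NormedModule) (fun t => fst (f t)) (fst ab) (snd ab) y /\ ball l1 eps y) /\
     (exists y, is_RInt (V := R_NormedModule) (fun t => snd (f t)) (fst ab) (snd ab) y /\ ball l2 eps y))).
  { apply (filter_and (F := filter_prod Fa Fb)).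
    - apply (H1 (ball l1 eps)). exists eps; auto.
    - apply (H2 (ball l2 eps)). exists eps; auto. }
  unfold filtermapi. revert K. apply filter_imp. intros ab [[y1 [A1 B1]] [y2 [A2 B2]]].
  exists (y1, y2). split.
  - exact (is_RInt_fct_extend_pair (U := R_NormedModule) (V := R_NormedModule) f _ _ y1 y2 A1 A2).
  - apply HP. split; assumption.
Qed.

Lemma minus_plus_middle (G : AbelianGroup) (x y z : G) :
  minus (plus x (plus y z)) y = plus x z.
Proof.
  unfold minus. rewrite (plus_comm y z), (plus_assoc x z y), <- (plus_assoc (plus x z)), plus_opp_r.
  apply plus_zero_r.
Qed.

(* Cauchy criterion: with [E' = e], the oscillation of [E] near the endpoints bounds that of
   the integral of [f]. *)
Lemma ex_RInt_gen_dominated (V : CompleteNormedModule R_AbsRing)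
    (Fa Fb : (R -> Prop) -> Prop) (FFa : ProperFilter Fa) (FFb : ProperFilter Fb)
    (f : R -> V) (e E : R -> R) (la lb : R) :
  Fa (fun t => 0 < t)%R -> Fb (fun t => 0 < t)%R ->
  (forall t, (0 < t)%R -> continuous f t) ->
  (forall t, (0 < t)%R -> continuous e t) ->
  (forall t, (0 < t)%R -> is_derive E t (e t)) ->
  (forall t, (0 < t)%R -> (norm (f t) <= e t)%R) ->
  filterlim E Fa (locally la) -> filterlim E Fb (locally lb) ->
  ex_RInt_gen f Fa Fb.
Proof.
  intros Pa Pb Cf Ce DE Hle La Lb.
  assert (Hint : forall x y, (0 < x)%R -> (0 < y)%R -> ex_RInt f x y).
  { intros x y Hx Hy. apply (ex_RInt_continuous (V := V)). intros z Hz. apply Cf.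
    destruct Hz as [Hz _]. revert Hz. unfold Rmin. destruct (Rle_dec x y); lra. }
  assert (Hb0 : forall x y, (0 < x)%R -> (x <= y)%R -> (norm (RInt f x y) <= Rabs (E y - E x))%R).
  { intros x y Hx Hy.
    apply Rle_trans with (E y - E x)%R; [ | apply Rle_abs].
    apply (norm_RInt_le f e x y _ _ Hy).
    - intros t Ht. apply Hle. lra.
    - apply (RInt_correct (V := V)). apply Hint; lra.
    - apply (is_RInt_derive (V := R_CompleteNormedModule) E e).
      + intros t. rewrite Rmin_left by lra. intros Ht. apply DE. lra.
      + intros t. rewrite Rmin_left by lra. intros Ht. apply Ce. lra. }
  (* Two points near the same endpoint come in no particular order, so the bound is also needed for
     reversed limits of integration. *)
  assert (Hb : forall x y, (0 < x)%R -> (0 < y)%R -> (norm (RInt f x y) <= Rabs (E y - E x))%R).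
  { intros x y Hx Hy. destruct (Rle_dec x y) as [H|H]; auto.
    replace (RInt f x y) with (opp (RInt f y x)) by (apply (opp_RInt_swap (V := V)), Hint; auto).
    rewrite Rabs_minus_sym. eapply Rle_trans; [right; exact (norm_opp _) | apply Hb0; lra]. }
  unfold ex_RInt_gen, is_RInt_gen. apply (filterlimi_locally_cauchy (U := V)).
  - exists (fun t => (0 < t)%R) (fun t => (0 < t)%R); auto.
    intros x y Hx Hy; split.
    + exists (RInt f x y). apply (RInt_correct (V := V)), Hint; auto.
    + intros y1 y2 H1 H2. rewrite <- (is_RInt_unique (V := V) _ _ _ _ H1).
      apply (is_RInt_unique (V := V) _ _ _ _ H2).
  - intros eps.
    (* Two values of [E] within [eps / 4] of the limit differ by less than [eps / 2], and there is
       one such pair at each endpoint. *)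
    assert (He : (0 < eps / 4)%R) by (destruct eps; simpl; lra).
    exists (fun ab => (0 < fst ab /\ ball la (eps / 4) (E (fst ab)))%R /\
                      (0 < snd ab /\ ball lb (eps / 4) (E (snd ab)))%R).
    split.
    + exists (fun t => 0 < t /\ ball la (eps / 4) (E t))%R (fun t => 0 < t /\ ball lb (eps / 4) (E t))%R; auto.
      * apply filter_and; auto. apply La. exists (mkposreal _ He). auto.
      * apply filter_and; auto. apply Lb. exists (mkposreal _ He). auto.
    + intros [a b] [a' b'] [[A1 A2] [B1 B2]] [[A1' A2'] [B1' B2']] u v Hu Hv; simpl in *.
      apply (is_RInt_unique (V := V)) in Hu. apply (is_RInt_unique (V := V)) in Hv. subst u v.
      apply (norm_compat1 (V := V)).
      assert (Heq : minus (RInt f a' b') (RInt f a b) = plus (RInt f a' a) (RInt f b b')).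
      { rewrite <- (RInt_Chasles f a' a b') by (apply Hint; auto).
        rewrite <- (RInt_Chasles f a b b') by (apply Hint; auto).
        exact (minus_plus_middle _ _ _ _). }
      assert (Htri : (norm (minus (RInt f a' b') (RInt f a b)) <=
                      norm (RInt f a' a) + norm (RInt f b b'))%R)
        by (rewrite Heq; exact (norm_triangle _ _)).
      eapply Rle_lt_trans; [exact Htri | ].
      pose proof (Hb a' a A1' A1). pose proof (Hb b b' B1 B1').
      unfold ball in A2, A2', B2, B2'. simpl in A2, A2', B2, B2'.
      unfold AbsRing_ball, abs, minus, plus, opp in A2, A2', B2, B2'. simpl in A2, A2', B2, B2'.
      apply Rabs_def2 in A2. apply Rabs_def2 in A2'. apply Rabs_def2 in B2. apply Rabs_def2 in B2'.
      assert (Rabs (E a - E a') < eps / 2)%R by (apply Rabs_def1; lra).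
      assert (Rabs (E b' - E b) < eps / 2)%R by (apply Rabs_def1; lra).
      lra.
Qed.

Lemma is_RInt_gen_antiderivative (Fa Fb : (R -> Prop) -> Prop) (FFa : Filter Fa) (FFb : Filter Fb)
    (F f : R -> R) (la lb : R) :
  Fa (fun t => 0 < t)%R -> Fb (fun t => 0 < t)%R ->
  (forall t, (0 < t)%R -> is_derive F t (f t)) ->
  (forall t, (0 < t)%R -> continuous f t) ->
  filterlim F Fa (locally la) -> filterlim F Fb (locally lb) ->
  is_RInt_gen f Fa Fb (lb - la)%R.
Proof.
  intros Pa Pb DF Cf La Lb.
  assert (HD : forall t, (0 < t)%R -> Derive F t = f t)
    by (intros t Ht; apply is_derive_unique, DF, Ht).
  assert (Hpos : forall a b t, (0 < a)%R -> (0 < b)%R -> (Rmin a b <= t)%R -> (0 < t)%R).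
  { intros a b t Ha Hb. unfold Rmin; destruct (Rle_dec a b); lra. }
  apply (is_RInt_gen_ext (Derive F)).
  - exists (fun t => 0 < t)%R (fun t => 0 < t)%R; auto; simpl.
    intros a b Ha Hb t Ht. apply HD. apply (Hpos a b); auto; lra.
  - apply is_RInt_gen_Derive; auto.
    + exists (fun t => 0 < t)%R (fun t => 0 < t)%R; auto; simpl.
      intros a b Ha Hb t [Ht _]. exists (f t). apply DF. apply (Hpos a b); auto.
    + exists (fun t => 0 < t)%R (fun t => 0 < t)%R; auto; simpl.
      intros a b Ha Hb t [Ht _]. assert (0 < t)%R by (apply (Hpos a b); auto).
      apply (continuous_ext_loc _ f).
      * apply (filter_imp (fun s => 0 < s)%R).
        { intros s Hs. symmetry. apply HD, Hs. }
        exact (open_gt 0 t H).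
      * apply Cf, H.
Qed.

(** * The Gamma function in the right half-plane *)

Lemma Cexp_plus (z w : C) : Cexp (z + w) = Cexp z * Cexp w.
Proof.
  unfold Cexp, Cmult, RtoC, Re, Im; simpl.
  rewrite exp_plus, cos_plus, sin_plus. f_equal; ring.
Qed.

Lemma Cexp_0 : Cexp 0 = 1.
Proof. unfold Cexp, Cmult, RtoC, Re, Im; simpl. rewrite exp_0, cos_0, sin_0. f_equal; ring. Qed.

Lemma Cmod_Cexp (z : C) : Cmod (Cexp z) = exp (Re z).
Proof.
  unfold Cexp. rewrite Cmod_mult, Cmod_R, Rabs_pos_eq by (left; apply exp_pos).
  assert (H : Cmod (cos (Im z), sin (Im z)) = 1%R).
  { unfold Cmod; simpl. rewrite !Rmult_1_r, <- sqrt_1. f_equal.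
    pose proof (sin2_cos2 (Im z)). unfold Rsqr in H. lra. }
  rewrite H. ring.
Qed.

Lemma Cexp_neq_0 (z : C) : Cexp z <> 0.
Proof. apply Cmod_gt_0. rewrite Cmod_Cexp. apply exp_pos. Qed.

Lemma Cexp_RtoC (x : R) : Cexp (RtoC x) = RtoC (exp x).
Proof. unfold Cexp, Cmult, RtoC, Re, Im; simpl. rewrite cos_0, sin_0. f_equal; ring. Qed.

Lemma Clog_pos (t : R) : (0 < t)%R -> Clog (RtoC t) = RtoC (ln t).
Proof.
  intros Ht. unfold Clog, Carg. rewrite Cmod_R, Rabs_pos_eq by lra. simpl.
  destruct (Rle_dec 0 0); [ | lra]. replace (t / t)%R with 1%R by (field; lra).
  rewrite acos_1. reflexivity.
Qed.

Lemma Cpower_pos (t : R) (s : C) : (0 < t)%R -> Cpower (RtoC t) s = Cexp (s * RtoC (ln t)).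
Proof. intros Ht. unfold Cpower. rewrite Clog_pos by auto. reflexivity. Qed.

(** The exponent is not shifted: the integrand of [Cgamma z] is [gamma_integrand (z - 1)]. *)
Definition gamma_integrand (s : C) (t : R) : C := Cpower (RtoC t) s * RtoC (exp (- t)).

Lemma gamma_integrand_components (s : C) (t : R) : (0 < t)%R ->
  gamma_integrand s t =
  ((exp (Re s * ln t - t) * cos (Im s * ln t))%R, (exp (Re s * ln t - t) * sin (Im s * ln t))%R).
Proof.
  intros Ht. unfold gamma_integrand. rewrite Cpower_pos by auto.
  replace (s * RtoC (ln t)) with ((Re s * ln t)%R, (Im s * ln t)%R)
    by (unfold Cmult, RtoC, Re, Im; simpl; f_equal; ring).
  unfold Cexp, Cmult, RtoC, Re, Im; simpl.
  unfold Rminus. rewrite exp_plus. f_equal; ring.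
Qed.

Lemma norm_C_R (z : C) : norm (V := C_R_NormedModule) z = Cmod z.
Proof.
  unfold norm; simpl. unfold prod_norm, Cmod. f_equal.
  unfold norm; simpl. unfold abs; simpl. rewrite !Rmult_1_r, <- !Rabs_mult.
  rewrite !Rabs_pos_eq by nra. reflexivity.
Qed.

Lemma norm_gamma_integrand (s : C) (t : R) : (0 < t)%R ->
  norm (V := C_R_NormedModule) (gamma_integrand s t) = exp (Re s * ln t - t).
Proof.
  intros Ht.
  rewrite norm_C_R. unfold gamma_integrand.
  rewrite Cmod_mult, Cpower_pos, Cmod_Cexp, Cmod_R by auto.
  rewrite Rabs_pos_eq by (left; apply exp_pos). rewrite <- exp_plus. f_equal.
  unfold Cmult, RtoC, Re; simpl. ring.
Qed.

Lemma continuous_gamma_integrand (s : C) (t : R) : (0 < t)%R ->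
  continuous (U := C_R_NormedModule) (gamma_integrand s) t.
Proof.
  intros Ht.
  apply (continuous_ext_loc _ (fun t => ((exp (Re s * ln t - t) * cos (Im s * ln t))%R,
     (exp (Re s * ln t - t) * sin (Im s * ln t))%R) : C_R_NormedModule)).
  - apply (filter_imp (fun u => 0 < u)%R).
    + intros u Hu. symmetry. apply gamma_integrand_components, Hu.
    + exact (open_gt 0 t Ht).
  - apply (continuous_comp_2 (U := R_UniformSpace) (V := R_UniformSpace) (W := R_UniformSpace)
       _ _ (fun x y => (x, y) : C_R_NormedModule)).
    + apply (ex_derive_continuous (V := R_NormedModule)). auto_derive. auto.
    + apply (ex_derive_continuous (V := R_NormedModule)). auto_derive. auto.
    + intros P HP. unfold filtermap. revert HP. apply filter_imp. intros [x y]; auto.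
Qed.

Lemma is_lim_exp_mul_ln_0 (x : R) : (0 < x)%R ->
  filterlim (fun t => exp (x * ln t)) (at_right 0) (locally 0%R).
Proof.
  intros Hx.
  apply (filterlim_comp _ _ _ (fun t => x * ln t)%R exp _ (Rbar_locally m_infty)).
  - apply (filterlim_comp _ _ _ ln (fun u => x * u)%R _ (Rbar_locally m_infty)).
    + exact is_lim_ln_0.
    + intros P [M HM]. exists (M / x)%R. intros u Hu. apply HM.
      apply (Rmult_lt_compat_l x) in Hu; auto. field_simplify in Hu; lra.
  - exact is_lim_exp_m.
Qed.

Lemma is_lim_exp_mul_ln_p (x : R) : (0 < x)%R ->
  filterlim (fun t => exp (x * ln t)) (Rbar_locally p_infty) (Rbar_locally p_infty).
Proof.
  intros Hx.
  apply (filterlim_comp _ _ _ (fun t => x * ln t)%R exp _ (Rbar_locally p_infty)).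
  - apply (filterlim_comp _ _ _ ln (fun u => x * u)%R _ (Rbar_locally p_infty)).
    + exact is_lim_ln_p.
    + intros P [M HM]. exists (M / x)%R. intros u Hu. apply HM.
      apply (Rmult_lt_compat_l x) in Hu; auto. field_simplify in Hu; lra.
  - exact is_lim_exp_p.
Qed.

Lemma exp_monotone (x y : R) : (x <= y)%R -> (exp x <= exp y)%R.
Proof. intros [H | ->]; [left; apply exp_increasing, H | apply Rle_refl]. Qed.

(** The maximum of t^x exp(-t) is at t = x; the bound is ln u <= u - 1 at u = t / x. *)
Lemma exp_mul_ln_sub_bounded (x : R) : (0 < x)%R ->
  exists K, forall t, (0 < t)%R -> (exp (x * ln t - t) <= K)%R.
Proof.
  intros Hx. exists (exp (x * (ln x - 1))). intros t Ht.
  apply exp_monotone.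
  assert (Hl : (ln (t / x) <= t / x - 1)%R).
  { assert (0 < t / x)%R by (apply Rdiv_lt_0_compat; auto).
    pose proof (exp_ineq1_le (ln (t / x))). rewrite exp_ln in H0 by auto. lra. }
  rewrite ln_div in Hl by auto.
  apply (Rmult_le_compat_l x) in Hl; [ | lra].
  replace (x * (t / x - 1))%R with (t - x)%R in Hl by (field; lra). lra.
Qed.

(** The dominating function is the derivative of -c / (1 + t^x). This single antiderivative has
    limits both at 0 and at infinity, so the integral is not split at an interior point. *)
Lemma ex_RInt_gen_gamma (z : C) : (0 < Re z)%R ->
  ex_RInt_gen (V := C_R_CompleteNormedModule) (gamma_integrand (z - 1))
    (at_right 0) (Rbar_locally p_infty).
Proof.
  intros Hz. set (x := Re z) in *.
  destruct (exp_mul_ln_sub_bounded (2 * x)) as [K HK]; [lra | ].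
  assert (K0 : (0 <= K)%R).
  { pose proof (HK 1%R Rlt_0_1). pose proof (exp_pos (2 * x * ln 1 - 1)). lra. }
  (* With u = t^x, exp(-t) (1 + u)^2 <= 2 exp(-t) (1 + u^2) <= 2 (1 + K), and this has to be at most
     c x. *)
  set (c := (2 * (1 + K) / x)%R).
  assert (Hc : (0 < c)%R) by (unfold c; apply Rdiv_lt_0_compat; lra).
  apply (ex_RInt_gen_dominated C_R_CompleteNormedModule _ _ _ _ _
    (fun t => c * (x * exp ((x - 1) * ln t) / (1 + exp (x * ln t)) ^ 2))%R
    (fun t => c * (- / (1 + exp (x * ln t))))%R (c * (- / (1 + 0)))%R 0%R).
  - exists (mkposreal 1 Rlt_0_1). auto.
  - exists 0%R; auto.
  - intros t Ht. apply continuous_gamma_integrand, Ht.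
  - intros t Ht. apply (ex_derive_continuous (V := R_NormedModule)). auto_derive.
    pose proof (exp_pos (x * ln t)). repeat split; auto. nra.
  - intros t Ht. pose proof (exp_pos (x * ln t)). auto_derive.
    + repeat split; auto; lra.
    + replace ((x - 1) * ln t)%R with (x * ln t + - ln t)%R by ring.
      rewrite exp_plus, (exp_Ropp (ln t)), (exp_ln t) by auto. field. lra.
  - intros t Ht. rewrite norm_gamma_integrand by auto.
    replace (Re (z - 1) * ln t - t)%R with ((x - 1) * ln t + - t)%R
      by (unfold x, Re; simpl; ring).
    rewrite exp_plus. pose proof (exp_pos ((x - 1) * ln t)) as P1.
    set (u := exp (x * ln t)) in *. assert (Hu : (0 < u)%R) by apply exp_pos.
    assert (Hm : (exp (- t) * (1 + u) ^ 2 <= c * x)%R).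
    { replace (c * x)%R with (2 * (1 + K))%R by (unfold c; field; lra).
      assert (Hu2 : (exp (- t) * u ^ 2 <= K)%R).
      { unfold u. replace (exp (x * ln t) ^ 2)%R with (exp (2 * x * ln t)).
        - rewrite <- exp_plus. replace (- t + 2 * x * ln t)%R with (2 * x * ln t - t)%R by ring.
          apply HK, Ht.
        - simpl. rewrite Rmult_1_r, <- exp_plus. f_equal. ring. }
      assert (He : (exp (- t) <= 1)%R).
      { rewrite <- exp_0. apply exp_monotone. lra. }
      pose proof (exp_pos (- t)). pose proof (Rmult_le_pos _ _ (Rlt_le _ _ H) (pow2_ge_0 (1 - u))). lra. }
    replace (c * (x * exp ((x - 1) * ln t) / (1 + u) ^ 2))%R
      with (exp ((x - 1) * ln t) * (c * x / (1 + u) ^ 2))%R by (field; lra).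
    apply Rmult_le_compat_l; [lra | ].
    apply (Rmult_le_reg_r ((1 + u) ^ 2)); [nra | ].
    replace (c * x / (1 + u) ^ 2 * (1 + u) ^ 2)%R with (c * x)%R by (field; lra). exact Hm.
  - apply (filterlim_comp _ _ _ (fun t => exp (x * ln t)) (fun u => c * (- / (1 + u)))%R _ (locally 0%R)).
    + apply is_lim_exp_mul_ln_0, Hz.
    + apply (ex_derive_continuous (V := R_NormedModule) (fun u => c * (- / (1 + u)))%R). auto_derive. lra.
  - apply (filterlim_comp _ _ _ (fun t => exp (x * ln t)) (fun u => c * (- / (1 + u)))%R _ (Rbar_locally p_infty)).
    + apply is_lim_exp_mul_ln_p, Hz.
    + assert (L : is_lim (fun u => c * (- / (1 + u)))%R p_infty (Rbar_mult c (Rbar_opp (Rbar_inv p_infty)))).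
      { apply is_lim_scal_l, is_lim_opp. apply is_lim_inv; [ | discriminate].
        apply (is_lim_plus _ _ _ 1 p_infty p_infty).
        - apply is_lim_const.
        - apply is_lim_id.
        - reflexivity. }
      simpl in L. rewrite Ropp_0, Rmult_0_r in L. exact L.
Qed.

Lemma is_RInt_gen_Cgamma (z : C) : (0 < Re z)%R ->
  is_RInt_gen (V := C_R_NormedModule) (gamma_integrand (z - 1))
    (at_right 0) (Rbar_locally p_infty) (Cgamma z).
Proof.
  intros Hz.
  apply (RInt_gen_correct (V := C_R_CompleteNormedModule)).
  apply ex_RInt_gen_gamma, Hz.
Qed.

Lemma filterlim_0_of_le (F : (R -> Prop) -> Prop) (FF : Filter F) (f g : R -> R) :
  F (fun t => Rabs (f t) <= g t)%R -> filterlim g F (locally 0%R) -> filterlim f F (locally 0%R).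
Proof.
  intros Hle Hg.
  apply (filterlim_le_le (fun t => - g t)%R f g 0%R).
  - revert Hle. apply filter_imp. intros t Ht. apply Rabs_le_between. exact Ht.
  - replace 0%R with (- 0)%R by ring.
    apply (filterlim_comp _ _ _ g Ropp _ (locally 0%R)); auto.
    exact (filterlim_opp (V := R_NormedModule) 0%R).
  - exact Hg.
Qed.

(** Together with its analogue at infinity, this disposes of the boundary terms in the integration
    by parts for [Cgamma_succ]; [h] stands for the cosine or sine of Im z ln t. *)
Lemma filterlim_damped_power_0 (x : R) (h : R -> R) : (0 < x)%R ->
  (forall t, (Rabs (h t) <= 1)%R) ->
  filterlim (fun t => exp (x * ln t - t) * h t)%R (at_right 0) (locally 0%R).
Proof.
  intros Hx Hh.
  apply (filterlim_0_of_le _ _ _ (fun t => exp (x * ln t))).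
  - exists (mkposreal 1 Rlt_0_1). intros t _ Ht.
    rewrite Rabs_mult, (Rabs_pos_eq (exp _)) by (left; apply exp_pos).
    rewrite <- (Rmult_1_r (exp (x * ln t))).
    apply Rmult_le_compat; [left; apply exp_pos | apply Rabs_pos | | apply Hh].
    apply exp_monotone. lra.
  - apply is_lim_exp_mul_ln_0, Hx.
Qed.

Lemma filterlim_damped_power_p (x : R) (h : R -> R) : (0 < x)%R ->
  (forall t, (Rabs (h t) <= 1)%R) ->
  filterlim (fun t => exp (x * ln t - t) * h t)%R (Rbar_locally p_infty) (locally 0%R).
Proof.
  intros Hx Hh.
  destruct (exp_mul_ln_sub_bounded (x + 1)) as [K HK]; [lra | ].
  apply (filterlim_0_of_le _ _ _ (fun t => K * / t)%R).
  - exists 0%R. intros t Ht.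
    rewrite Rabs_mult, (Rabs_pos_eq (exp _)) by (left; apply exp_pos).
    rewrite <- (Rmult_1_r (K * / t)).
    apply Rmult_le_compat; [left; apply exp_pos | apply Rabs_pos | | apply Hh].
    (* t^x exp(-t) is t^(x+1) exp(-t) divided by t, and the numerator is bounded. *)
    replace (x * ln t - t)%R with ((x + 1) * ln t - t + - ln t)%R by ring.
    rewrite exp_plus, (exp_Ropp (ln t)), exp_ln by auto.
    apply Rmult_le_compat_r; [left; apply Rinv_0_lt_compat, Ht | apply HK, Ht].
  - assert (L : is_lim (fun t => K * / t)%R p_infty (Rbar_mult K (Rbar_inv p_infty))).
    { apply is_lim_scal_l, is_lim_inv; [apply is_lim_id | discriminate]. }
    simpl in L. rewrite Rmult_0_r in L. exact L.
Qed.

Lemma is_RInt_gen_0_unique (f : R -> R) (l1 l2 : R) :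
  is_RInt_gen (V := R_NormedModule) f (at_right 0) (Rbar_locally p_infty) l1 ->
  is_RInt_gen (V := R_NormedModule) f (at_right 0) (Rbar_locally p_infty) l2 -> l1 = l2.
Proof.
  intros H1 H2.
  rewrite <- (is_RInt_gen_unique (V := R_CompleteNormedModule) _ _ H1).
  apply (is_RInt_gen_unique (V := R_CompleteNormedModule) _ _ H2).
Qed.

Lemma at_right_0_pos : at_right 0 (fun t => 0 < t)%R.
Proof. exists (mkposreal 1 Rlt_0_1). auto. Qed.

Lemma p_infty_pos : Rbar_locally p_infty (fun t => 0 < t)%R.
Proof. exists 0%R. auto. Qed.

Lemma is_RInt_gen_ext_pos (f g : R -> R) (l : R) :
  (forall t, (0 < t)%R -> f t = g t) ->
  is_RInt_gen (V := R_NormedModule) f (at_right 0) (Rbar_locally p_infty) l ->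
  is_RInt_gen (V := R_NormedModule) g (at_right 0) (Rbar_locally p_infty) l.
Proof.
  intros He. apply (is_RInt_gen_ext (V := R_NormedModule)).
  exists (fun t => 0 < t)%R (fun t => 0 < t)%R;
    [apply at_right_0_pos | apply p_infty_pos | simpl].
  intros a b Ha Hb t [Ht _]. apply He. revert Ht. unfold Rmin; destruct (Rle_dec a b); lra.
Qed.

(** Integration by parts: z t^(z-1) exp(-t) - t^z exp(-t) is the derivative of t^z exp(-t), which
    vanishes at both ends. Real and imaginary parts are treated separately, with antiderivatives
    exp(x ln t - t) times the cosine or sine of y ln t. *)
Lemma Cgamma_succ (z : C) : (0 < Re z)%R -> Cgamma (z + 1) = z * Cgamma z.
Proof.
  intros Hz.
  pose proof (is_RInt_gen_Cgamma z Hz) as H.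
  assert (Hz1 : (0 < Re (z + 1))%R) by (unfold Re in *; simpl; lra).
  pose proof (is_RInt_gen_Cgamma (z + 1) Hz1) as H1.
  replace (z + 1 - 1) with z in H1 by ring.
  destruct z as [x y]. unfold Re in Hz; simpl in Hz.
  destruct (Cgamma (x, y)) as [p q]. destruct (Cgamma ((x, y) + 1)) as [p1 q1].
  assert (Hcomp : forall t, (0 < t)%R ->
    gamma_integrand ((x, y) - 1) t =
      ((exp (x * ln t - t) * cos (y * ln t) / t)%R, (exp (x * ln t - t) * sin (y * ln t) / t)%R)).
  { intros t Ht. rewrite gamma_integrand_components by auto. unfold Re, Im; simpl.
    replace ((x + - (1)) * ln t - t)%R with (x * ln t - t + - ln t)%R by ring.
    rewrite exp_plus, (exp_Ropp (ln t)), exp_ln by auto.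
    replace ((y + - 0) * ln t)%R with (y * ln t)%R by ring. f_equal; field; lra. }
  assert (Hcomp1 : forall t, (0 < t)%R ->
    gamma_integrand (x, y) t =
      ((exp (x * ln t - t) * cos (y * ln t))%R, (exp (x * ln t - t) * sin (y * ln t))%R)).
  { intros t Ht. rewrite gamma_integrand_components by auto. reflexivity. }
  pose proof (is_RInt_gen_fst _ _ _ _ H) as Hp. pose proof (is_RInt_gen_snd _ _ _ _ H) as Hq.
  pose proof (is_RInt_gen_fst _ _ _ _ H1) as Hp1. pose proof (is_RInt_gen_snd _ _ _ _ H1) as Hq1.
  cbn [fst snd] in Hp, Hq, Hp1, Hq1.
  assert (E1 : (x * p - y * q - p1 = 0 - 0)%R).
  { eapply is_RInt_gen_0_unique.
    - apply (is_RInt_gen_minus (V := R_NormedModule)).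
      + apply (is_RInt_gen_minus (V := R_NormedModule)).
        * exact (is_RInt_gen_scal (V := R_NormedModule) _ x _ Hp).
        * exact (is_RInt_gen_scal (V := R_NormedModule) _ y _ Hq).
      + exact Hp1.
    - eapply is_RInt_gen_ext_pos;
        [ | apply (is_RInt_gen_antiderivative _ _ _ _ (fun t => exp (x * ln t - t) * cos (y * ln t))%R
              (fun t => exp (x * ln t - t) * ((x / t - 1) * cos (y * ln t) - y / t * sin (y * ln t)))%R)].
      + intros t Ht. rewrite Hcomp, Hcomp1 by auto.
        unfold minus, plus, opp, scal; simpl. unfold mult; simpl. field. lra.
      + apply at_right_0_pos.
      + apply p_infty_pos.
      + intros t Ht. auto_derive; auto.
        change (x * ln t + - t)%R with (x * ln t - t)%R. field. lra.
      + intros t Ht. apply (ex_derive_continuous (V := R_NormedModule)). auto_derive.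
        repeat split; auto; lra.
      + apply filterlim_damped_power_0; auto. intros t. apply Rabs_le_between, COS_bound.
      + apply filterlim_damped_power_p; auto. intros t. apply Rabs_le_between, COS_bound. }
  assert (E2 : (x * q + y * p - q1 = 0 - 0)%R).
  { eapply is_RInt_gen_0_unique.
    - apply (is_RInt_gen_minus (V := R_NormedModule)).
      + apply (is_RInt_gen_plus (V := R_NormedModule)).
        * exact (is_RInt_gen_scal (V := R_NormedModule) _ x _ Hq).
        * exact (is_RInt_gen_scal (V := R_NormedModule) _ y _ Hp).
      + exact Hq1.
    - eapply is_RInt_gen_ext_pos;
        [ | apply (is_RInt_gen_antiderivative _ _ _ _ (fun t => exp (x * ln t - t) * sin (y * ln t))%R
              (fun t => exp (x * ln t - t) * ((x / t - 1) * sin (y * ln t) + y / t * cos (y * ln t)))%R)].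
      + intros t Ht. rewrite Hcomp, Hcomp1 by auto.
        unfold minus, plus, opp, scal; simpl. unfold mult; simpl. field. lra.
      + apply at_right_0_pos.
      + apply p_infty_pos.
      + intros t Ht. auto_derive; auto.
        change (x * ln t + - t)%R with (x * ln t - t)%R. field. lra.
      + intros t Ht. apply (ex_derive_continuous (V := R_NormedModule)). auto_derive.
        repeat split; auto; lra.
      + apply filterlim_damped_power_0; auto. intros t. apply Rabs_le_between, SIN_bound.
      + apply filterlim_damped_power_p; auto. intros t. apply Rabs_le_between, SIN_bound. }
  unfold Cmult; simpl. f_equal; lra.
Qed.

Lemma Cgamma_1 : Cgamma 1 = 1.
Proof.
  unfold Cgamma. fold (gamma_integrand (1 - 1)).
  apply (is_RInt_gen_unique (V := C_R_CompleteNormedModule) (gamma_integrand (1 - 1)) (RtoC 1)).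
  assert (Hc : forall t, (0 < t)%R -> gamma_integrand (1 - 1) t = RtoC (exp (- t))).
  { intros t Ht. rewrite gamma_integrand_components by auto. unfold Re, Im, RtoC; simpl.
    replace ((1 + - (1)) * ln t - t)%R with (- t)%R by ring.
    replace ((0 + - 0) * ln t)%R with 0%R by ring. rewrite cos_0, sin_0. f_equal; ring. }
  assert (H1 : is_RInt_gen (V := R_NormedModule) (fun t => exp (- t)) (at_right 0)
     (Rbar_locally p_infty) (0 - - exp (- 0))%R).
  { apply (is_RInt_gen_antiderivative _ _ _ _ (fun t => - exp (- t))%R).
    - apply at_right_0_pos.
    - apply p_infty_pos.
    - intros t Ht. auto_derive; auto. ring.
    - intros t Ht. apply (ex_derive_continuous (V := R_NormedModule)). auto_derive. auto.
    - eapply filterlim_filter_le_1.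
      + apply filter_le_within.
      + apply (ex_derive_continuous (V := R_NormedModule) (fun t => - exp (- t))%R). auto_derive. auto.
    - assert (L : is_lim (fun t => - exp (- t))%R p_infty (Rbar_opp 0)).
      { apply is_lim_opp. apply (is_lim_comp exp _ p_infty 0 m_infty).
        - exact is_lim_exp_m.
        - apply (is_lim_opp (fun t => t) p_infty p_infty), is_lim_id.
        - exists 0%R. intros; discriminate. }
      simpl in L. rewrite Ropp_0 in L. exact L. }
  assert (H0 : is_RInt_gen (V := R_NormedModule) (fun t => 0%R) (at_right 0)
     (Rbar_locally p_infty) (0 - 0)%R).
  { apply (is_RInt_gen_antiderivative _ _ _ _ (fun t => 0%R)).
    - apply at_right_0_pos.
    - apply p_infty_pos.
    - intros t Ht. apply (is_derive_const (V := R_NormedModule)).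
    - intros t Ht. apply continuous_const.
    - apply filterlim_const.
    - apply filterlim_const. }
  replace (0 - - exp (- 0))%R with 1%R in H1 by (rewrite Ropp_0, exp_0; ring).
  rewrite Rminus_0_r in H0.
  apply (is_RInt_gen_pair _ _ _ _ _ 1%R 0%R).
  - eapply is_RInt_gen_ext_pos; [ | exact H1].
    intros t Ht. rewrite Hc by auto. reflexivity.
  - eapply is_RInt_gen_ext_pos; [ | exact H0].
    intros t Ht. rewrite Hc by auto. reflexivity.
Qed.

Fixpoint rising (z : C) (k : nat) : C :=
  match k with O => 1 | S k => rising z k * (z + INR k) end.

Lemma Re_plus_INR (z : C) (k : nat) : (0 < Re z)%R -> (0 < Re (z + INR k))%R.
Proof. intros Hz. pose proof (pos_INR k). unfold Re in *; simpl. lra. Qed.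

Lemma RtoC_S (k : nat) : RtoC (INR (S k)) = RtoC (INR k) + 1.
Proof. rewrite S_INR, RtoC_plus. reflexivity. Qed.

Lemma Cgamma_plus_nat (z : C) (k : nat) : (0 < Re z)%R -> Cgamma (z + INR k) = rising z k * Cgamma z.
Proof.
  intros Hz. induction k as [ | k IH]; simpl rising.
  - simpl. rewrite Cplus_0_r. ring.
  - rewrite RtoC_S, Cplus_assoc, Cgamma_succ, IH by (apply Re_plus_INR, Hz). ring.
Qed.

Lemma Cgamma_nat (k : nat) : Cgamma (INR k + 1) = INR (fact k).
Proof.
  induction k as [ | k IH].
  - simpl. rewrite Cplus_0_l. apply Cgamma_1.
  - rewrite RtoC_S, Cgamma_succ.
    + rewrite IH. simpl fact. rewrite <- RtoC_S, <- RtoC_mult, <- mult_INR. reflexivity.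
    + rewrite <- RtoC_S. unfold Re; simpl. apply (lt_0_INR (S k)). lia.
Qed.

Lemma is_RInt_gen_Cmult (c : C) (f : R -> C) (l : C) :
  is_RInt_gen (V := C_R_NormedModule) f (at_right 0) (Rbar_locally p_infty) l ->
  is_RInt_gen (V := C_R_NormedModule) (fun t => c * f t) (at_right 0) (Rbar_locally p_infty) (c * l).
Proof.
  intros H. destruct c as [x y], l as [p q].
  pose proof (is_RInt_gen_fst _ _ _ _ H) as Hp. pose proof (is_RInt_gen_snd _ _ _ _ H) as Hq.
  cbn [fst snd] in Hp, Hq.
  apply (is_RInt_gen_pair _ _ _ _ _ (x * p - y * q)%R (x * q + y * p)%R).
  - exact (is_RInt_gen_minus (V := R_NormedModule) _ _ _ _
      (is_RInt_gen_scal (V := R_NormedModule) _ x _ Hp)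
      (is_RInt_gen_scal (V := R_NormedModule) _ y _ Hq)).
  - exact (is_RInt_gen_plus (V := R_NormedModule) _ _ _ _
      (is_RInt_gen_scal (V := R_NormedModule) _ x _ Hq)
      (is_RInt_gen_scal (V := R_NormedModule) _ y _ Hp)).
Qed.

Lemma is_RInt_gen_moment (k : nat) :
  is_RInt_gen (V := R_NormedModule) (fun t => exp (INR k * ln t - t))%R
    (at_right 0) (Rbar_locally p_infty) (INR (fact k)).
Proof.
  assert (Hk : (0 < Re (INR k + 1))%R) by (pose proof (pos_INR k); unfold Re; simpl; lra).
  pose proof (is_RInt_gen_Cgamma _ Hk) as H. rewrite Cgamma_nat in H.
  apply is_RInt_gen_fst in H. cbn [fst RtoC] in H.
  eapply is_RInt_gen_ext_pos; [ | exact H].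
  intros t Ht. cbv beta. rewrite gamma_integrand_components by auto. unfold Re, Im; simpl.
  replace ((INR k + 1 + - (1)) * ln t)%R with (INR k * ln t)%R by ring.
  replace ((0 + 0 + - 0) * ln t)%R with 0%R by ring. rewrite cos_0. apply Rmult_1_r.
Qed.

(** * The growth of Gamma: Gamma(s + N + 1) ~ N! N^s *)

Lemma Rabs_sin_le (x : R) : (Rabs (sin x) <= Rabs x)%R.
Proof.
  destruct (MVT_gen sin 0 x cos) as [c [_ Hc]].
  - intros t _. apply is_derive_Reals, derivable_pt_lim_sin.
  - intros t _. apply continuity_sin.
  - rewrite sin_0 in Hc. replace (sin x) with (cos c * x)%R by lra.
    rewrite Rabs_mult. rewrite <- (Rmult_1_l (Rabs x)) at 2.
    apply Rmult_le_compat_r; [apply Rabs_pos | apply Rabs_le_between, COS_bound].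
Qed.

(** |exp(ix) - 1| = 2 |sin(x / 2)|. *)
Lemma Cmod_cis_sub_1 (x : R) : (Cmod ((cos x, sin x) - 1) <= Rabs x)%R.
Proof.
  apply Rsqr_incr_0_var; [ | apply Rabs_pos].
  assert (Hc : (Rsqr (Cmod ((cos x, sin x) - 1)) = 4 * Rsqr (sin (x / 2)))%R).
  { unfold Rsqr. replace (Cmod ((cos x, sin x) - 1) * Cmod ((cos x, sin x) - 1))%R
      with (Cmod ((cos x, sin x) - 1) ^ 2)%R by ring.
    rewrite Cmod2_alt. unfold Re, Im; simpl.
    replace (cos x) with (1 - 2 * sin (x / 2) * sin (x / 2))%R.
    - pose proof (sin2_cos2 x) as H. unfold Rsqr in H.
      replace (cos x) with (1 - 2 * sin (x / 2) * sin (x / 2))%R in H.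
      + nra.
      + replace x with (2 * (x / 2))%R at 3 by field. rewrite cos_2a_sin. ring.
    - replace x with (2 * (x / 2))%R at 3 by field. rewrite cos_2a_sin. ring. }
  rewrite Hc, <- Rsqr_abs.
  pose proof (Rabs_sin_le (x / 2)) as H. apply Rsqr_le_abs_1 in H.
  unfold Rsqr in *. nra.
Qed.

(** Trades a complex exponent for an integer one, whose moments are factorials. With u = exp L and x
    = Re s, the modulus contributes |u^x - 1| <= |u^m - 1|, and the phase at most min(1, u^x) |Im s|
    |L|, where x min(1, u^x) |L| <= |u^x - 1| by exp v >= 1 + v. *)
Lemma Cmod_Cexp_sub_1 (s : C) (L : R) (m : nat) : (0 < Re s)%R -> (Re s <= INR m)%R ->
  (Cmod (Cexp (s * L) - 1) <= (1 + Rabs (Im s) / Re s) * Rabs (exp (INR m * L) - 1))%R.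
Proof.
  intros Hs Hm. set (x := Re s) in *. set (y := Im s).
  assert (Hd : (Rabs (exp (x * L) - 1) <= Rabs (exp (INR m * L) - 1))%R).
  { destruct (Rle_dec 0 L) as [HL | HL].
    - assert (1 <= exp (x * L))%R by (rewrite <- exp_0; apply exp_monotone; nra).
      assert (exp (x * L) <= exp (INR m * L))%R by (apply exp_monotone; nra).
      rewrite !Rabs_pos_eq by lra. lra.
    - assert (exp (x * L) <= 1)%R by (rewrite <- exp_0; apply exp_monotone; nra).
      assert (exp (INR m * L) <= exp (x * L))%R by (apply exp_monotone; nra).
      rewrite !Rabs_left1 by lra. lra. }
  assert (E : Cexp (s * L) = RtoC (exp (x * L)) * (cos (y * L), sin (y * L))).
  { unfold Cexp. unfold x, y, Re, Im; simpl. f_equal; [ f_equal; f_equal; ring | ].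
    f_equal; f_equal; ring. }
  set (w := (cos (y * L), sin (y * L))) in *.
  assert (Hw : Cmod w = 1%R).
  { unfold w, Cmod; simpl. rewrite !Rmult_1_r, <- sqrt_1. f_equal.
    pose proof (sin2_cos2 (y * L)) as H. unfold Rsqr in H. lra. }
  pose proof (Cmod_cis_sub_1 (y * L)) as Hw1. fold w in Hw1.
  pose proof (exp_pos (x * L)) as Hp.
  (* The phase error is weighted by the smaller of 1 and u^x: the product is split so that [w - 1]
     is multiplied by that factor. *)
  assert (Hkey : (Cmod (Cexp (s * L) - 1) <=
                  Rabs (exp (x * L) - 1) + Rmin 1 (exp (x * L)) * (Rabs y * Rabs L))%R).
  { rewrite E, <- Rabs_mult. unfold Rmin. destruct (Rle_dec 1 (exp (x * L))).
    - replace (RtoC (exp (x * L)) * w - 1) with (RtoC (exp (x * L) - 1) * w + (w - 1))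
        by (rewrite RtoC_minus; ring).
      eapply Rle_trans; [apply Cmod_triangle | ].
      rewrite Cmod_mult, Cmod_R, Hw. lra.
    - replace (RtoC (exp (x * L)) * w - 1) with (RtoC (exp (x * L) - 1) + RtoC (exp (x * L)) * (w - 1))
        by (rewrite RtoC_minus; ring).
      eapply Rle_trans; [apply Cmod_triangle | ].
      rewrite Cmod_mult, !Cmod_R, (Rabs_pos_eq (exp _)) by lra.
      apply Rplus_le_compat_l, Rmult_le_compat_l; lra. }
  assert (Hmin : (Rmin 1 (exp (x * L)) * Rabs L <= / x * Rabs (exp (x * L) - 1))%R).
  { apply (Rmult_le_reg_l x); auto.
    replace (x * (/ x * Rabs (exp (x * L) - 1)))%R with (Rabs (exp (x * L) - 1)) by (field; lra).
    destruct (Rle_dec 0 L) as [HL | HL].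
    - assert (1 <= exp (x * L))%R by (rewrite <- exp_0; apply exp_monotone; nra).
      rewrite Rmin_left, !Rabs_pos_eq by lra. pose proof (exp_ineq1_le (x * L)). lra.
    - assert (exp (x * L) <= 1)%R by (rewrite <- exp_0; apply exp_monotone; nra).
      rewrite Rmin_right, !Rabs_left1 by lra.
      pose proof (exp_ineq1_le (- (x * L))) as H1. rewrite exp_Ropp in H1.
      apply (Rmult_le_compat_l (exp (x * L))) in H1; [ | lra].
      rewrite Rinv_r in H1 by lra. lra. }
  eapply Rle_trans; [exact Hkey | ].
  eapply Rle_trans; [ | apply Rmult_le_compat_l; [ | exact Hd]].
  - replace (Rmin 1 (exp (x * L)) * (Rabs y * Rabs L))%R
      with (Rabs y * (Rmin 1 (exp (x * L)) * Rabs L))%R by ring.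
    apply (Rmult_le_compat_l (Rabs y)) in Hmin; [ | apply Rabs_pos].
    unfold Rdiv. lra.
  - pose proof (Rabs_pos y). assert (0 < / x)%R by (apply Rinv_0_lt_compat; auto).
    unfold Rdiv. nra.
Qed.

Lemma is_lim_seq_fact_ratio (m : nat) :
  is_lim_seq (fun N => INR (fact (S N + m)) / (INR (fact (S N)) * INR (S N) ^ m))%R 1%R.
Proof.
  induction m as [ | m IH].
  - apply (is_lim_seq_ext (fun _ => 1%R)); [ | apply is_lim_seq_const].
    intros N. rewrite Nat.add_0_r. simpl pow. field. apply INR_fact_neq_0.
  - apply (is_lim_seq_ext (fun N => INR (fact (S N + m)) / (INR (fact (S N)) * INR (S N) ^ m) *
       (1 + INR (S m) * / INR (S N)))%R).
    + intros N.
      assert (Hf : fact (S N + S m) = ((S N + S m) * fact (S N + m))%nat)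
        by (rewrite Nat.add_succ_r; reflexivity).
      rewrite Hf, mult_INR, plus_INR. rewrite <- (tech_pow_Rmult (INR (S N)) m).
      field. repeat split; try apply INR_fact_neq_0; try apply pow_nonzero;
        apply not_0_INR; discriminate.
    + replace (Finite 1) with (Finite (1 * (1 + INR (S m) * 0))) by (f_equal; ring).
      apply is_lim_seq_mult'; [exact IH | ].
      apply is_lim_seq_plus'; [apply is_lim_seq_const | ].
      apply is_lim_seq_mult'; [apply is_lim_seq_const | ].
      replace (Finite 0) with (Rbar_inv p_infty) by reflexivity.
      apply is_lim_seq_inv; [ | discriminate].
      apply (is_lim_seq_incr_1 INR), is_lim_seq_INR.
Qed.

Definition gamma_ratio (s : C) (N : nat) : C :=
  Cgamma (s + INR N + 1) / (RtoC (INR (fact N)) * Cexp (s * ln (INR N))).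

(* With [u = t / N] and weight [t^N exp(-t)], the integrand of the difference is
   [u^s - 1 = O(|u^m - 1|)], and [2 |u^m - 1| <= e + (u^m - 1)^2 / e] has explicit moments. *)
Lemma gamma_ratio_bound (s : C) (m N : nat) (e : R) :
  (0 < Re s)%R -> (Re s <= INR m)%R -> (0 < e)%R -> (0 < N)%nat ->
  (Cmod (gamma_ratio s N - 1) <= (1 + Rabs (Im s) / Re s) * (e / 2 + / (2 * e) *
    (INR (fact (N + (m + m))) / (INR (fact N) * INR N ^ (m + m))
     - 2 * (INR (fact (N + m)) / (INR (fact N) * INR N ^ m)) + 1)))%R.
Proof.
  intros Hs Hm He HN.
  assert (Hn : (0 < INR N)%R) by (apply lt_0_INR; auto).
  set (n := INR N) in *. set (K := (1 + Rabs (Im s) / Re s)%R).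
  assert (HK : (0 < K)%R).
  { unfold K, Rdiv. pose proof (Rabs_pos (Im s)).
    assert (0 < / Re s)%R by (apply Rinv_0_lt_compat; auto). nra. }
  assert (HF : (0 < INR (fact N))%R) by apply INR_fact_lt_0.
  set (P := Cexp (s * ln n)).
  assert (HP : Cmod P = exp (Re s * ln n)).
  { unfold P. rewrite Cmod_Cexp. f_equal. unfold Re; simpl. ring. }
  assert (HsN : (0 < Re (s + INR N + 1))%R).
  { pose proof (pos_INR N). unfold Re in *; simpl. lra. }
  assert (HN1 : (0 < Re (INR N + 1))%R).
  { pose proof (pos_INR N). unfold Re in *; simpl. lra. }
  pose proof (is_RInt_gen_Cgamma _ HsN) as H1.
  pose proof (is_RInt_gen_Cmult P _ _ (is_RInt_gen_Cgamma _ HN1)) as H2.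
  pose proof (is_RInt_gen_minus (V := C_R_NormedModule) _ _ _ _ H1 H2) as H3.
  rewrite Cgamma_nat in H3.
  pose proof (is_RInt_gen_moment N) as M0.
  pose proof (is_RInt_gen_moment (N + m)) as M1.
  pose proof (is_RInt_gen_moment (N + (m + m))) as M2.
  (* The majorant N^(Re s) K t^N exp(-t) (e / 2 + (v - 1)^2 / (2 e)), where v = (t / N)^m, expanded
     in powers of v: it is a combination of the moments of order N, N + m and N + 2m. *)
  pose proof (is_RInt_gen_scal (V := R_NormedModule) _ (exp (Re s * ln n) * K * (e / 2 + / (2 * e)))%R _ M0) as N0.
  pose proof (is_RInt_gen_scal (V := R_NormedModule) _ (exp (Re s * ln n) * K * (/ (2 * e) * (2 / n ^ m)))%R _ M1) as N1.
  pose proof (is_RInt_gen_scal (V := R_NormedModule) _ (exp (Re s * ln n) * K * (/ (2 * e) / n ^ (m + m)))%R _ M2) as N2.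
  pose proof (is_RInt_gen_plus (V := R_NormedModule) _ _ _ _
     (is_RInt_gen_minus (V := R_NormedModule) _ _ _ _ N0 N1) N2) as H4.
  assert (Hnm : (0 < n ^ m)%R) by (apply pow_lt; auto).
  assert (Hle : (Cmod (Cgamma (s + INR N + 1) - P * INR (fact N)) <=
     exp (Re s * ln n) * INR (fact N) * (K * (e / 2 + / (2 * e) *
    (INR (fact (N + (m + m))) / (INR (fact N) * n ^ (m + m))
     - 2 * (INR (fact (N + m)) / (INR (fact N) * n ^ m)) + 1))))%R).
  { rewrite <- norm_C_R.
    change (Cgamma (s + INR N + 1) - P * INR (fact N))
      with (minus (Cgamma (s + INR N + 1)) (P * INR (fact N) : C_R_NormedModule)).
    eapply Rle_trans; [refine (RInt_gen_norm (V := C_R_CompleteNormedModule) _ _ _ _ _ _ H3 H4) | ].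
    (* [RInt_gen_norm] asks for ordered endpoints; 1 separates them. *)
    - exists (fun t => 0 < t < 1)%R (fun t => 1 < t)%R.
      + exists (mkposreal 1 Rlt_0_1). intros y Hy Hy0.
        unfold ball in Hy; simpl in Hy. unfold AbsRing_ball, abs, minus, plus, opp in Hy; simpl in Hy.
        apply Rabs_def2 in Hy. lra.
      + exists 1%R. auto.
      + simpl. intros. lra.
    - exists (fun t => 0 < t)%R (fun t => 0 < t)%R; [apply at_right_0_pos | apply p_infty_pos | ].
      simpl. intros a b Ha Hb t [Hta Htb]. assert (Ht : (0 < t)%R) by lra.
      set (L := (ln t - ln n)%R).
      set (v := exp (INR m * L)). set (W := exp (INR N * ln t - t)).
      assert (HW : (0 < W)%R) by apply exp_pos.
      assert (Hnk : forall k, exp (INR k * ln n) = (n ^ k)%R) by (intros k; apply (Rpower_pow k n Hn)).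
      assert (Ev : forall k, exp (INR (N + k) * ln t - t) = (W * exp (INR k * L) * n ^ k)%R).
      { intros k. rewrite <- Hnk. unfold W. rewrite <- !exp_plus. f_equal.
        rewrite plus_INR. unfold L. ring. }
      assert (Evv : exp (INR (m + m) * L) = (v * v)%R).
      { unfold v. rewrite <- exp_plus. f_equal. rewrite plus_INR. ring. }
      rewrite !Ev, Evv. fold v.
      assert (Ed : minus (gamma_integrand (s + INR N + 1 - 1) t)
                     (P * gamma_integrand (INR N + 1 - 1) t : C_R_NormedModule)
                   = P * RtoC W * (Cexp (s * L) - 1)).
      { unfold gamma_integrand. rewrite !Cpower_pos by auto.
        replace ((s + INR N + 1 - 1) * ln t) with (s * ln n + s * L + RtoC (INR N * ln t))
          by (unfold L; rewrite RtoC_minus, RtoC_mult; ring).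
        replace ((INR N + 1 - 1) * ln t) with (RtoC (INR N * ln t)) by (rewrite RtoC_mult; ring).
        rewrite !Cexp_plus, Cexp_RtoC. fold P.
        unfold W. unfold Rminus at 1. rewrite exp_plus, RtoC_mult.
        change (P * Cexp (s * L) * exp (INR N * ln t) * exp (- t) - P * (exp (INR N * ln t) * exp (- t)) =
          P * (exp (INR N * ln t) * exp (- t)) * (Cexp (s * L) - 1)). ring. }
      eapply Rle_trans; [right; etransitivity;
        [exact (f_equal (fun z => norm (z : C_R_NormedModule)) Ed) | exact (norm_C_R _)] | ].
      rewrite !Cmod_mult, HP, Cmod_R, (Rabs_pos_eq W) by lra.
      pose proof (Cmod_Cexp_sub_1 s L m Hs Hm) as Hdiff. fold K v in Hdiff.
      unfold minus, plus, opp, scal; simpl. unfold mult; simpl.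
      set (Q := exp (Re s * ln n)). assert (HQ : (0 < Q)%R) by apply exp_pos.
      replace (Q * K * (e / 2 + / (2 * e)) * W + - (Q * K * (/ (2 * e) * (2 / n ^ m)) * (W * v * n ^ m)) +
         Q * K * (/ (2 * e) / n ^ (m + m)) * (W * (v * v) * n ^ (m + m)))%R
        with (Q * W * (K * (e / 2 + / (2 * e) * (v - 1) ^ 2)))%R
        by (rewrite pow_add; field; split; lra).
      apply Rmult_le_compat_l; [nra | ].
      eapply Rle_trans; [exact Hdiff | ]. apply Rmult_le_compat_l; [lra | ].
      rewrite <- (pow2_abs (v - 1)). set (r := Rabs (v - 1)).
      apply Rmult_le_reg_l with (2 * e)%R; [lra | ].
      replace (2 * e * (e / 2 + / (2 * e) * r ^ 2))%R with (e ^ 2 + r ^ 2)%R by (field; lra).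
      pose proof (pow2_ge_0 (e - r)). lra.
    - right. unfold minus, plus, opp, scal; simpl. unfold mult; simpl.
      rewrite pow_add. field. repeat split; lra. }
  assert (Hden : RtoC (INR (fact N)) * P <> 0).
  { apply Cmod_gt_0. rewrite Cmod_mult, Cmod_R, HP, Rabs_pos_eq by lra.
    pose proof (exp_pos (Re s * ln n)). nra. }
  replace (gamma_ratio s N - 1)
    with ((Cgamma (s + INR N + 1) - P * INR (fact N)) / (RtoC (INR (fact N)) * P))
    by (unfold gamma_ratio; fold n P; field; split; intros H; apply Hden; rewrite H; ring).
  rewrite Cmod_div, Cmod_mult, Cmod_R, HP, (Rabs_pos_eq (INR (fact N))) by (auto; lra).
  pose proof (exp_pos (Re s * ln n)).
  apply Rle_div_l; [nra | ]. eapply Rle_trans; [exact Hle | ]. right. ring.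
Qed.

(** For fixed [e] the bracket of [gamma_ratio_bound] tends to 1 - 2 + 1 = 0, leaving K e / 2 with
    [e] arbitrary. The index is [S N] because that bound requires a positive one. *)
Lemma is_lim_gamma_ratio (s : C) : (0 < Re s)%R ->
  is_lim_seq (fun N => Cmod (gamma_ratio s (S N) - 1)) 0%R.
Proof.
  intros Hs.
  destruct (nfloor_ex (Re s)) as [m0 [_ Hm0]]; [lra | ].
  set (m := S m0). assert (Hm : (Re s <= INR m)%R) by (unfold m; rewrite S_INR; lra).
  set (K := (1 + Rabs (Im s) / Re s)%R).
  assert (HK : (0 < K)%R).
  { unfold K, Rdiv. pose proof (Rabs_pos (Im s)).
    assert (0 < / Re s)%R by (apply Rinv_0_lt_compat; auto). nra. }
  apply is_lim_seq_spec. intros eps. set (e := (eps / K)%R).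
  assert (He : (0 < e)%R) by (apply Rdiv_lt_0_compat; auto; apply cond_pos).
  pose proof (is_lim_seq_plus' _ _ _ _
    (is_lim_seq_minus' _ _ _ _ (is_lim_seq_fact_ratio (m + m))
      (is_lim_seq_mult' _ _ _ _ (is_lim_seq_const 2) (is_lim_seq_fact_ratio m)))
    (is_lim_seq_const 1)) as L.
  replace (1 - 2 * 1 + 1)%R with 0%R in L by ring.
  apply is_lim_seq_spec in L.
  (* A bracket below e^2 / 2 contributes less than e / 4 after division by 2 e, and K (e / 2 + e /
     4) < K e = eps. *)
  assert (He2 : (0 < e * e / 2)%R) by nra.
  specialize (L (mkposreal _ He2)). revert L. apply filter_imp. intros N HN.
  simpl pos in HN. rewrite Rminus_0_r in *.
  rewrite Rabs_pos_eq by apply Cmod_ge_0.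
  eapply Rle_lt_trans; [apply (gamma_ratio_bound s m (S N) e); auto; lia | ].
  fold K. apply Rabs_def2 in HN. destruct HN as [HN _].
  set (V := (_ - _ + 1)%R) in *.
  replace (pos eps) with (K * e)%R by (unfold e; field; lra).
  apply Rmult_lt_compat_l; auto.
  apply (Rmult_lt_compat_l (/ (2 * e))) in HN; [ | apply Rinv_0_lt_compat; lra].
  replace (/ (2 * e) * (e * e / 2))%R with (e / 4)%R in HN by (field; lra). lra.
Qed.

(** * Limits of complex sequences, and nonvanishing of Gamma *)

(** Stated through moduli, so that squeezing and the arithmetic of real limits apply. *)
Definition Clim (u : nat -> C) (l : C) : Prop := is_lim_seq (fun n => Cmod (u n - l)) 0%R.

Lemma Clim_const (c : C) : Clim (fun _ => c) c.
Proof.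
  apply (is_lim_seq_ext (fun _ => 0%R)); [ | apply is_lim_seq_const].
  intros _. replace (c - c) with (RtoC 0) by ring. now rewrite Cmod_0.
Qed.

Lemma Clim_ext (u v : nat -> C) (l : C) : (forall n, u n = v n) -> Clim u l -> Clim v l.
Proof. intros H. apply is_lim_seq_ext. intros n. now rewrite H. Qed.

Lemma Clim_RtoC (u : nat -> R) (l : R) : is_lim_seq u l -> Clim (fun n => RtoC (u n)) (RtoC l).
Proof.
  intros H. apply (is_lim_seq_ext (fun n => Rabs (u n - l))).
  - intros n. now rewrite <- RtoC_minus, Cmod_R.
  - rewrite <- Rabs_R0. apply (is_lim_seq_abs _ (Finite 0)).
    replace (Finite 0) with (Finite (l - l)) by (f_equal; ring).
    apply is_lim_seq_minus'; [exact H | apply is_lim_seq_const].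
Qed.

Lemma Clim_mult (u v : nat -> C) (l m : C) : Clim u l -> Clim v m -> Clim (fun n => u n * v n) (l * m).
Proof.
  unfold Clim. intros Hu Hv.
  apply (is_lim_seq_le_le (fun _ => 0%R) _ (fun n => Cmod (u n - l) * Cmod (v n - m) +
      Cmod (u n - l) * Cmod m + Cmod l * Cmod (v n - m))%R).
  - intros n. split; [apply Cmod_ge_0 | ].
    replace (u n * v n - l * m) with ((u n - l) * (v n - m) + (u n - l) * m + l * (v n - m)) by ring.
    rewrite <- !Cmod_mult.
    eapply Rle_trans; [apply Cmod_triangle | apply Rplus_le_compat_r, Cmod_triangle].
  - apply is_lim_seq_const.
  - replace (Finite 0) with (Finite (0 * 0 + 0 * Cmod m + Cmod l * 0)) by (f_equal; ring).
    apply is_lim_seq_plus'; [apply is_lim_seq_plus' | ];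
      apply is_lim_seq_mult'; auto; apply is_lim_seq_const.
Qed.

Lemma Clim_unique (u : nat -> C) (l m : C) : Clim u l -> Clim u m -> l = m.
Proof.
  intros Hl Hm.
  assert (H : is_lim_seq (fun _ => Cmod (l - m)) 0%R).
  { apply (is_lim_seq_le_le (fun _ => 0%R) _ (fun n => Cmod (u n - l) + Cmod (u n - m))%R).
    - intros n. split; [apply Cmod_ge_0 | ].
      replace (l - m) with (- (u n - l) + (u n - m)) by ring.
      rewrite <- (Cmod_opp (u n - l)). apply Cmod_triangle.
    - apply is_lim_seq_const.
    - replace (Finite 0) with (Finite (0 + 0)) by (f_equal; ring).
      apply is_lim_seq_plus'; auto. }
  apply is_lim_seq_unique in H. rewrite Lim_seq_const in H. injection H as H.
  apply Cmod_eq_0 in H. replace l with (l - m + m) by ring. rewrite H. ring.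
Qed.

Lemma Cneq_0_of_Re_pos (z : C) : (0 < Re z)%R -> z <> 0.
Proof. intros H E. rewrite E in H. unfold Re in H; simpl in H. lra. Qed.

Lemma INR_fact_C (n : nat) : RtoC (INR (fact n)) <> 0.
Proof. intros H. apply RtoC_inj in H. exact (INR_fact_neq_0 n H). Qed.

Lemma Cgamma_shift (s : C) (N : nat) : (0 < Re s)%R ->
  Cgamma (s + INR N + 1) = rising (s + 1) N * Cgamma (s + 1).
Proof.
  intros Hs. replace (s + INR N + 1) with (s + 1 + INR N) by ring.
  apply Cgamma_plus_nat. unfold Re in *; simpl. lra.
Qed.

(** A zero at z would propagate by the functional equation to every z + N + 1, and then
    [gamma_ratio z] could not tend to 1. *)
Lemma Cgamma_neq_0 (z : C) : (0 < Re z)%R -> Cgamma z <> 0.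
Proof.
  intros Hz H0.
  assert (L : Clim (fun N => gamma_ratio z (S N)) 1) by exact (is_lim_gamma_ratio z Hz).
  assert (E : Clim (fun N => gamma_ratio z (S N)) 0).
  { apply (Clim_ext (fun _ => 0)); [ | apply Clim_const].
    intros N. unfold gamma_ratio. rewrite Cgamma_shift, Cgamma_succ, H0 by auto.
    unfold Cdiv. ring. }
  pose proof (Clim_unique _ _ _ L E) as H. apply RtoC_inj in H. lra.
Qed.

(** * The coefficients of [(1 - z) ^ a] *)

(** The number (-a)_k / k!, by its recurrence: when Re a > 0, Euler's integral does not give
    Gamma(-a). *)
Fixpoint pow_coef (a : C) (k : nat) : C :=
  match k with O => 1 | S k => pow_coef a k * ((INR k - a) / INR (S k)) end.

Lemma RtoC_INR_S_neq_0 (k : nat) : RtoC (INR (S k)) <> 0.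
Proof. intros H. apply RtoC_inj in H. revert H. apply not_0_INR. discriminate. Qed.

Lemma pow_coef_S (a : C) (k : nat) : INR (S k) * pow_coef a (S k) = (INR k - a) * pow_coef a k.
Proof. cbn [pow_coef]. field. apply RtoC_INR_S_neq_0. Qed.

Lemma Cconj_RtoC (x : R) : Cconj (RtoC x) = RtoC x.
Proof. unfold Cconj, RtoC; simpl. f_equal. ring. Qed.

Lemma eventually_nonincreasing_bounded (u : nat -> R) (K : nat) :
  (forall k, (K <= k)%nat -> (u (S k) <= u k)%R) -> exists M, forall k, (u k <= M)%R.
Proof.
  revert u. induction K as [ | K IH]; intros u H.
  - exists (u O). intros k. induction k as [ | k IHk]; [apply Rle_refl | ].
    eapply Rle_trans; [apply H; lia | exact IHk].
  - destruct (IH (fun k => u (S k))) as [M HM].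
    + intros k Hk. apply H. lia.
    + exists (Rmax (u O) M). intros [ | k]; [apply Rmax_l | ].
      eapply Rle_trans; [apply HM | apply Rmax_r].
Qed.

(** By the recurrence (k + 1) |f_(k+1)| = |k - a| |f_k|, and |k - a|^2 = k^2 - 2 k Re a + |a|^2 is
    at most k^2 as soon as k >= |a|^2 / (2 Re a); from there on k |f_k| does not increase. The rate
    1 / k suffices for square summability and for the boundary terms. *)
Lemma pow_coef_decay (a : C) : (0 < Re a)%R ->
  exists M, forall k, (INR k * Cmod (pow_coef a k) <= M)%R.
Proof.
  intros Ha.
  destruct (nfloor_ex (Cmod a ^ 2 / (2 * Re a))) as [K [_ HK]].
  { apply Rle_mult_inv_pos; [apply pow2_ge_0 | lra]. }
  apply (eventually_nonincreasing_bounded _ (S K)). intros k Hk.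
  assert (E : (INR (S k) * Cmod (pow_coef a (S k)) = Cmod (INR k - a) * Cmod (pow_coef a k))%R).
  { rewrite <- Cmod_mult, <- pow_coef_S, Cmod_mult, Cmod_R, Rabs_pos_eq; auto. apply pos_INR. }
  rewrite E. apply Rmult_le_compat_r; [apply Cmod_ge_0 | ].
  apply Rsqr_incr_0_var; [ | apply pos_INR]. rewrite !Rsqr_pow2.
  rewrite !Cmod2_alt in *. unfold Re, Im in *; simpl in *.
  assert (Hk2 : (INR K + 1 <= INR k)%R) by (rewrite <- S_INR; apply le_INR, Hk).
  assert (Hl : ((fst a * (fst a * 1) + snd a * (snd a * 1)) < INR k * (2 * fst a))%R).
  { apply Rlt_div_l; lra. }
  nra.
Qed.

Lemma is_lim_pow_coef (a : C) : (0 < Re a)%R -> is_lim_seq (fun k => Cmod (pow_coef a k)) 0%R.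
Proof.
  intros Ha. destruct (pow_coef_decay a Ha) as [M HM].
  apply is_lim_seq_incr_1.
  apply (is_lim_seq_le_le (fun _ => 0%R) _ (fun k => M * / INR (S k))%R).
  - intros k. split; [apply Cmod_ge_0 | ].
    assert (0 < INR (S k))%R by (apply lt_0_INR; lia).
    apply (Rmult_le_reg_l (INR (S k))); auto.
    replace (INR (S k) * (M * / INR (S k)))%R with M by (field; lra). apply HM.
  - apply is_lim_seq_const.
  - replace (Finite 0) with (Rbar_mult M (Rbar_inv p_infty)) by (simpl; f_equal; ring).
    apply is_lim_seq_scal_l, is_lim_seq_inv; [ | discriminate].
    apply (is_lim_seq_incr_1 INR), is_lim_seq_INR.
Qed.

Lemma is_series_telescope (T : nat -> R) (l : R) :
  is_lim_seq T l -> is_series (fun k => T (S k) - T k)%R (l - T O)%R.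
Proof.
  intros H. change (is_lim_seq (sum_n (fun k => T (S k) - T k)%R) (Finite (l - T O))).
  apply (is_lim_seq_ext (fun n => T (S n) - T O)%R).
  - intros n. induction n as [ | n IH].
    + now rewrite sum_O.
    + rewrite sum_Sn, <- IH. unfold plus; simpl. ring.
  - apply is_lim_seq_minus'; [ | apply is_lim_seq_const].
    apply (is_lim_seq_incr_1 T), H.
Qed.

Lemma ex_series_inv_square : ex_series (fun k => / (INR (S k) * INR (S (S k))))%R.
Proof.
  exists (- 0 - - / INR 1)%R.
  apply (is_series_ext (fun k => - / INR (S (S k)) - - / INR (S k))%R).
  - intros k. rewrite !S_INR. pose proof (pos_INR k).
      match goal with |- @eq _ ?b ?c => change (@eq R b c) end. field. lra.
  - apply (is_series_telescope (fun k => - / INR (S k))%R).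
    apply (is_lim_seq_opp _ (Finite 0)).
    replace (Finite 0) with (Rbar_inv p_infty) by reflexivity.
    apply is_lim_seq_inv; [ | discriminate].
    apply (is_lim_seq_incr_1 INR), is_lim_seq_INR.
Qed.

Lemma ex_series_pow_coef (a : C) : (0 < Re a)%R -> ex_series (fun k => Cmod (pow_coef a k) ^ 2)%R.
Proof.
  intros Ha. destruct (pow_coef_decay a Ha) as [M HM].
  apply ex_series_incr_1.
  (* From y x <= M with y = k + 1 >= 1 one gets x^2 <= M^2 / y^2 <= 2 M^2 / (y (y + 1)). *)
  apply (ex_series_le (V := R_CompleteNormedModule) _ (fun k => 2 * M ^ 2 * / (INR (S k) * INR (S (S k))))%R).
  - intros k. unfold norm; simpl. unfold abs; simpl.
    rewrite Rabs_pos_eq by (apply Rmult_le_pos; [ | rewrite Rmult_1_r]; apply Cmod_ge_0).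
    specialize (HM (S k)). set (x := Cmod (pow_coef a (S k))) in *.
    assert (0 <= x)%R by apply Cmod_ge_0.
    change (x * (x * 1) <= 2 * (M * (M * 1)) * / (INR (S k) * INR (S (S k))))%R.
    rewrite (S_INR (S k)). assert (1 <= INR (S k))%R by (apply (le_INR 1); lia).
    set (y := INR (S k)) in *.
    apply (Rmult_le_reg_r (y * (y + 1))); [nra | ].
    replace (2 * (M * (M * 1)) * / (y * (y + 1)) * (y * (y + 1)))%R with (2 * M ^ 2)%R by (field; lra).
    assert ((y * x) ^ 2 <= M ^ 2)%R by (apply pow_incr; split; [nra | exact HM]).
    assert (x * x * (y * (y + 1)) <= 2 * (y * x) ^ 2)%R by nra. lra.
  - exact (ex_series_scal_l (V := R_NormedModule) (2 * M ^ 2)%R _ ex_series_inv_square).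
Qed.

(** * Gauss's summation of [sum |f_k|^2] *)

(* [fact k / (n + 1)_k], the weight turning [sum |f_k|^2] into [2F1(-a, conj (-a); n + 1; 1)]. *)
Definition hyp_weight (n k : nat) : R := (INR (fact k) * INR (fact n) / INR (fact (n + k)))%R.

Lemma hyp_weight_0_l (k : nat) : hyp_weight 0 k = 1%R.
Proof. unfold hyp_weight. simpl. field. apply INR_fact_neq_0. Qed.

Lemma hyp_weight_0_r (n : nat) : hyp_weight n 0 = 1%R.
Proof. unfold hyp_weight. rewrite Nat.add_0_r. simpl. field. apply INR_fact_neq_0. Qed.

Lemma hyp_weight_S_r (n k : nat) :
  hyp_weight n (S k) = (hyp_weight n k * INR (S k) / (INR n + 1 + INR k))%R.
Proof.
  unfold hyp_weight. rewrite Nat.add_succ_r, !fact_simpl, !mult_INR, (S_INR (n + k)), plus_INR.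
  pose proof (pos_INR n). pose proof (pos_INR k).
  field. repeat split; try apply INR_fact_neq_0; lra.
Qed.

Lemma hyp_weight_S_l (n k : nat) :
  hyp_weight (S n) k = (hyp_weight n k * (INR n + 1) / (INR n + 1 + INR k))%R.
Proof.
  unfold hyp_weight. rewrite Nat.add_succ_l, !fact_simpl, !mult_INR, (S_INR (n + k)), (S_INR n), plus_INR.
  pose proof (pos_INR n). pose proof (pos_INR k).
  field. repeat split; try apply INR_fact_neq_0; lra.
Qed.

Lemma hyp_weight_pos (n k : nat) : (0 < hyp_weight n k)%R.
Proof.
  apply Rdiv_lt_0_compat; [apply Rmult_lt_0_compat | ]; apply INR_fact_lt_0.
Qed.

(** For k >= 1 the weight does not increase with k, and it equals 1 / (n + 1) at k = 1. The
    uniformity in k is what makes the tail of [hyp_sum] vanish as n grows. *)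
Lemma hyp_weight_le (n k : nat) : (hyp_weight n (S k) <= / (INR n + 1))%R.
Proof.
  pose proof (pos_INR n). induction k as [ | k IH]; rewrite hyp_weight_S_r.
  - rewrite hyp_weight_0_r. simpl. right. field. lra.
  - rewrite (S_INR (S k)). pose proof (hyp_weight_pos n (S k)). pose proof (pos_INR (S k)).
    apply Rle_div_l; [lra | ]. apply Rmult_le_compat; lra.
Qed.

Lemma hyp_weight_le_1 (n k : nat) : (hyp_weight n k <= 1)%R.
Proof.
  destruct k as [ | k]; [rewrite hyp_weight_0_r; lra | ].
  eapply Rle_trans; [apply hyp_weight_le | ].
  pose proof (pos_INR n). rewrite <- Rinv_1. apply Rinv_le_contravar; lra.
Qed.

Definition hyp_sum (a : C) (n : nat) : R := Series (fun k => Cmod (pow_coef a k) ^ 2 * hyp_weight n k)%R.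

Lemma ex_series_hyp_sum (a : C) (n : nat) : (0 < Re a)%R ->
  ex_series (fun k => Cmod (pow_coef a k) ^ 2 * hyp_weight n k)%R.
Proof.
  intros Ha. apply (ex_series_le (V := R_CompleteNormedModule) _ (fun k => Cmod (pow_coef a k) ^ 2)%R).
  - intros k. unfold norm; simpl. unfold abs; simpl.
    pose proof (hyp_weight_pos n k). pose proof (hyp_weight_le_1 n k).
    pose proof (Cmod_ge_0 (pow_coef a k)). rewrite Rmult_1_r.
    rewrite Rabs_pos_eq by (apply Rmult_le_pos; [nra | lra]).
    assert (0 <= Cmod (pow_coef a k) * Cmod (pow_coef a k))%R by nra. nra.
  - apply ex_series_pow_coef, Ha.
Qed.

(* Gauss's contiguous relation at [z = 1], by telescoping [c k t_k] with [c = n + 1]. *)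
Lemma hyp_sum_S (a : C) (n : nat) : (0 < Re a)%R ->
  (Cmod (INR n + 1 + a) ^ 2 * hyp_sum a (S n) = (INR n + 1) * (INR n + 1 + 2 * Re a) * hyp_sum a n)%R.
Proof.
  intros Ha. set (c := (INR n + 1)%R).
  assert (Hc : (0 < c)%R) by (pose proof (pos_INR n); unfold c; lra).
  set (T := fun k => (c * INR k * (Cmod (pow_coef a k) ^ 2 * hyp_weight n k))%R).
  (* k |f_k| is bounded, the weight is at most 1, and the remaining factor |f_k| tends to 0. *)
  assert (HT : is_lim_seq T 0%R).
  { destruct (pow_coef_decay a Ha) as [M HM].
    apply (is_lim_seq_le_le (fun _ => 0%R) _ (fun k => c * M * Cmod (pow_coef a k))%R).
    - intros k. unfold T. specialize (HM k).
      pose proof (hyp_weight_pos n k). pose proof (hyp_weight_le_1 n k).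
      pose proof (Cmod_ge_0 (pow_coef a k)). pose proof (pos_INR k).
      set (x := Cmod (pow_coef a k)) in *. set (w := hyp_weight n k) in *.
      assert (0 <= INR k * x)%R by nra.
      replace (c * INR k * (x ^ 2 * w))%R with (c * (INR k * x * (x * w)))%R by ring.
      split.
      + apply Rmult_le_pos; [lra | ]. apply Rmult_le_pos; [lra | nra].
      + replace (c * M * x)%R with (c * (M * x))%R by ring.
        apply Rmult_le_compat_l; [lra | ].
        apply Rmult_le_compat; nra.
    - apply is_lim_seq_const.
    - replace (Finite 0) with (Rbar_mult (c * M)%R 0%R) by (simpl; f_equal; ring).
      apply is_lim_seq_scal_l, is_lim_pow_coef, Ha. }
  pose proof (is_series_telescope T 0 HT) as H1.
  unfold hyp_sum. rewrite <- !Series_scal_l.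
  assert (E : (Series (fun k => Cmod (c + a) ^ 2 * (Cmod (pow_coef a k) ^ 2 * hyp_weight (S n) k)) -
     Series (fun k => c * (c + 2 * Re a) * (Cmod (pow_coef a k) ^ 2 * hyp_weight n k)) = 0 - T O)%R).
  { rewrite <- Series_minus.
    - apply is_series_unique. revert H1. apply is_series_ext. intros k.
      match goal with |- @eq _ ?b ?c => change (@eq R b c) end.
      unfold T. rewrite hyp_weight_S_r, hyp_weight_S_l. fold c.
      assert (Ek : (INR (S k) ^ 2 * Cmod (pow_coef a (S k)) ^ 2 =
                    Cmod (INR k - a) ^ 2 * Cmod (pow_coef a k) ^ 2)%R).
      { rewrite <- !Rpow_mult_distr, <- Cmod_mult, <- pow_coef_S, Cmod_mult, Cmod_R, Rabs_pos_eq; auto.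
        apply pos_INR. }
      pose proof (pos_INR k).
      assert (E1 : (Cmod (INR k - a) ^ 2 = INR k ^ 2 - 2 * Re a * INR k + Cmod a ^ 2)%R).
      { rewrite !Cmod2_alt. unfold Re, Im; simpl. ring. }
      assert (E2 : (Cmod (c + a) ^ 2 = c ^ 2 + 2 * Re a * c + Cmod a ^ 2)%R).
      { rewrite !Cmod2_alt. unfold Re, Im; simpl. ring. }
      replace (c * INR (S k) * (Cmod (pow_coef a (S k)) ^ 2 * (hyp_weight n k * INR (S k) / (c + INR k))))%R
        with (c * hyp_weight n k / (c + INR k) * (INR (S k) ^ 2 * Cmod (pow_coef a (S k)) ^ 2))%R
        by (field; lra).
      rewrite Ek, E1, E2. field. lra.
    - apply (ex_series_scal_l (V := R_NormedModule)), ex_series_hyp_sum, Ha.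
    - apply (ex_series_scal_l (V := R_NormedModule)), ex_series_hyp_sum, Ha. }
  unfold T in E. simpl INR in E. unfold c in *. rewrite RtoC_plus in E. lra.
Qed.

(** The contiguous relation iterated, without divisions. Writing |N + 1 + a|^2 as a product of
    conjugates and 2 Re a as a + conj a turns its factors into the rising factorials carried by
    Gamma(s + N + 1) for s = a, conj a and a + conj a. *)
Lemma hyp_sum_prod (a : C) (N : nat) : (0 < Re a)%R ->
  hyp_sum a 0 * INR (fact N) * rising (a + Cconj a + 1) N =
  rising (a + 1) N * rising (Cconj a + 1) N * hyp_sum a N.
Proof.
  intros Ha. induction N as [ | N IH].
  - simpl. ring.
  - pose proof (hyp_sum_S a N Ha) as H. apply (f_equal RtoC) in H.
    rewrite !RtoC_mult, Cmod2_conj in H.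
    cbn [rising]. rewrite fact_simpl, mult_INR, RtoC_mult.
    replace (hyp_sum a 0 * (INR (S N) * INR (fact N)) * (rising (a + Cconj a + 1) N * (a + Cconj a + 1 + INR N)))
      with (hyp_sum a 0 * INR (fact N) * rising (a + Cconj a + 1) N * (INR (S N) * (a + Cconj a + 1 + INR N)))
      by ring.
    rewrite IH.
    replace (rising (a + 1) N * (a + 1 + INR N) * (rising (Cconj a + 1) N * (Cconj a + 1 + INR N)) *
      hyp_sum a (S N)) with (rising (a + 1) N * rising (Cconj a + 1) N *
        ((INR N + 1 + a) * (INR N + 1 + Cconj a) * hyp_sum a (S N))) by ring.
    assert (E : (INR N + 1 + a) * (INR N + 1 + Cconj a) * hyp_sum a (S N) =
       (INR N + 1) * (INR N + 1 + (a + Cconj a)) * hyp_sum a N).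
    { replace (INR N + 1 + Cconj a) with (Cconj (INR N + 1 + a))
        by (rewrite !Cplus_conj, !Cconj_RtoC; reflexivity).
      rewrite H. replace (a + Cconj a) with (RtoC (2 * Re a)).
      - rewrite !RtoC_plus. reflexivity.
      - destruct a. unfold Cconj, Cplus, RtoC, Re; simpl. f_equal; ring. }
    rewrite E, RtoC_S. ring.
Qed.

(** The term k = 0 is 1 for every n, and the others sum to at most a constant over n + 1. *)
Lemma is_lim_hyp_sum (a : C) : (0 < Re a)%R -> is_lim_seq (hyp_sum a) 1%R.
Proof.
  intros Ha.
  pose proof (ex_series_pow_coef a Ha) as Hex.
  assert (Hex1 : ex_series (fun k => Cmod (pow_coef a (S k)) ^ 2)%R) by exact (proj1 (ex_series_incr_1 (V := R_NormedModule) _) Hex).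
  set (M := Series (fun k => Cmod (pow_coef a (S k)) ^ 2)%R).
  apply (is_lim_seq_le_le (fun _ => 1%R) _ (fun n => 1 + M * / INR (S n))%R).
  - intros n. unfold hyp_sum.
    rewrite Series_incr_1 by (apply ex_series_hyp_sum, Ha).
    rewrite hyp_weight_0_r. change (pow_coef a 0) with (RtoC 1). rewrite Cmod_1.
    assert (0 <= Series (fun k => Cmod (pow_coef a (S k)) ^ 2 * hyp_weight n (S k)) <= M * / INR (S n))%R; [ | lra].
    unfold M. rewrite <- Series_scal_r. split.
    + assert (E : (Series (fun _ : nat => 0%R) = 0)%R).
      { rewrite (Series_ext _ (fun _ => 0 * 0)%R) by (intros; ring). rewrite Series_scal_l. ring. }
      rewrite <- E at 1. apply Series_le.
      * intros k. split; [lra | ]. pose proof (hyp_weight_pos n (S k)).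
        apply Rmult_le_pos; [apply pow2_ge_0 | lra].
      * apply -> (ex_series_incr_1 (V := R_NormedModule)
          (fun k => Cmod (pow_coef a k) ^ 2 * hyp_weight n k)%R). apply ex_series_hyp_sum, Ha.
    + apply Series_le.
      * intros k. pose proof (hyp_weight_pos n (S k)). split.
        -- apply Rmult_le_pos; [apply pow2_ge_0 | lra].
        -- apply Rmult_le_compat_l; [apply pow2_ge_0 | ]. rewrite S_INR. apply hyp_weight_le.
      * apply ex_series_scal_r, Hex1.
  - apply is_lim_seq_const.
  - replace (Finite 1) with (Finite (1 + M * 0)) by (f_equal; ring).
    apply is_lim_seq_plus'; [apply is_lim_seq_const | ].
    apply is_lim_seq_mult'; [apply is_lim_seq_const | ].
    replace (Finite 0) with (Rbar_inv p_infty) by reflexivity.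
    apply is_lim_seq_inv; [ | discriminate].
    apply (is_lim_seq_incr_1 INR), is_lim_seq_INR.
Qed.

Lemma sum_sqr_pow_coef (a : C) : (0 < Re a)%R ->
  RtoC (Series (fun k => Cmod (pow_coef a k) ^ 2)%R) * (Cgamma (a + 1) * Cgamma (Cconj a + 1)) =
  Cgamma (a + Cconj a + 1).
Proof.
  intros Ha.
  assert (Hb : (0 < Re (Cconj a))%R) by (rewrite re_conj; auto).
  assert (Hab : (0 < Re (a + Cconj a))%R) by (unfold Re in *; simpl in *; lra).
  assert (E0 : Series (fun k => Cmod (pow_coef a k) ^ 2)%R = hyp_sum a 0).
  { apply Series_ext. intros k. rewrite hyp_weight_0_l. ring. }
  rewrite E0. set (S0 := hyp_sum a 0).
  (* One sequence, two limits: directly by the asymptotics for a + conj a, and, after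
     [hyp_sum_prod], by those for a and conj a. The powers of N match because N^(a + conj a) = N^a
     N^(conj a). *)
  apply (Clim_unique (fun N => S0 * (Cgamma (a + 1) * Cgamma (Cconj a + 1)) * gamma_ratio (a + Cconj a) (S N))).
  - pose proof (Clim_mult _ _ _ _ (Clim_const (S0 * (Cgamma (a + 1) * Cgamma (Cconj a + 1))))
      (is_lim_gamma_ratio _ Hab : Clim (fun N => gamma_ratio (a + Cconj a) (S N)) 1)) as L.
    rewrite Cmult_1_r in L. exact L.
  - apply (Clim_ext (fun N => Cgamma (a + Cconj a + 1) * (RtoC (hyp_sum a (S N)) *
      (gamma_ratio a (S N) * gamma_ratio (Cconj a) (S N))))).
    + intros N. unfold gamma_ratio. rewrite !Cgamma_shift by auto.
      pose proof (hyp_sum_prod a (S N) Ha) as HP. fold S0 in HP.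
      rewrite Cmult_plus_distr_r, Cexp_plus.
      pose proof (INR_fact_C (S N)) as HF.
      pose proof (Cexp_neq_0 (a * ln (INR (S N)))) as X1.
      pose proof (Cexp_neq_0 (Cconj a * ln (INR (S N)))) as X2.
      revert HP HF X1 X2.
      generalize (rising (a + Cconj a + 1) (S N)) (rising (a + 1) (S N)) (rising (Cconj a + 1) (S N))
        (RtoC (INR (fact (S N)))) (Cexp (a * ln (INR (S N)))) (Cexp (Cconj a * ln (INR (S N))))
        (RtoC (hyp_sum a (S N))).
      intros r r1 r2 F e1 e2 h HP HF X1 X2.
      transitivity (Cgamma (a + Cconj a + 1) * Cgamma (a + 1) * Cgamma (Cconj a + 1) / (F * F * e1 * e2)
        * (r1 * r2 * h)); [field; auto | ].
      rewrite <- HP. field; auto.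
    + pose proof (Clim_mult _ _ _ _ (Clim_const (Cgamma (a + Cconj a + 1)))
        (Clim_mult _ _ _ _
           (Clim_RtoC _ _ (proj1 (is_lim_seq_incr_1 (hyp_sum a) 1%R) (is_lim_hyp_sum a Ha)))
           (Clim_mult _ _ _ _
             (is_lim_gamma_ratio _ Ha : Clim (fun N => gamma_ratio a (S N)) 1)
             (is_lim_gamma_ratio _ Hb : Clim (fun N => gamma_ratio (Cconj a) (S N)) 1)))) as L.
      rewrite !Cmult_1_r in L. exact L.
Qed.

(** * The Taylor expansion of [(1 - z) ^ a] *)

(** Replaces the arc cosine and its case split by a single differentiable formula in the right
    half-plane, where 1 - z lies when |z| < 1. *)
Lemma Carg_atan (w : C) : (0 < Re w)%R -> Carg w = atan (Im w / Re w).
Proof.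
  intros Hw. destruct w as [x y]. unfold Carg, Re, Im in *; simpl in *.
  assert (Hs : (0 < x ^ 2 + y ^ 2)%R) by nra.
  assert (Hm : (0 < Cmod (x, y))%R) by (apply sqrt_lt_R0; exact Hs).
  assert (Hm2 : (Cmod (x, y) ^ 2 = x ^ 2 + y ^ 2)%R) by (rewrite Cmod2_alt; reflexivity).
  set (m := Cmod (x, y)) in *.
  assert (Hacos : acos (x / m) = atan (Rabs y / x)).
  { rewrite acos_atan by (apply Rdiv_lt_0_compat; auto). f_equal.
    replace (1 - Rsqr (x / m))%R with (Rsqr (Rabs y / m)).
    - rewrite sqrt_Rsqr by (apply Rle_mult_inv_pos; [apply Rabs_pos | auto]). field. lra.
    - rewrite !Rsqr_div', <- Rsqr_abs. unfold Rsqr.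
      replace (1 - x * x / (m * m))%R with ((m ^ 2 - x ^ 2) / (m * m))%R by (field; lra).
      rewrite Hm2. field. lra. }
  rewrite Hacos. destruct (Rle_dec 0 y).
  - rewrite Rabs_pos_eq by auto. reflexivity.
  - rewrite Rabs_left by lra. rewrite <- atan_opp. f_equal. field. lra.
Qed.

Lemma ln_Cmod (x y : R) : (0 < x ^ 2 + y ^ 2)%R -> ln (Cmod (x, y)) = (/ 2 * ln (x ^ 2 + y ^ 2))%R.
Proof.
  intros H. unfold Cmod; cbn [fst snd].
  assert (Hs : (0 < sqrt (x ^ 2 + y ^ 2))%R) by (apply sqrt_lt_R0, H).
  rewrite <- (sqrt_sqrt (x ^ 2 + y ^ 2)) at 2 by lra.
  rewrite ln_mult by auto. field.
Qed.

(** These are the real and imaginary parts of exp(p + iq) (U + iV), and the hypotheses say (U + iV)'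
    = -(p + iq)' (U + iV). *)
Lemma is_derive_rotation (p q U V : R -> R) (p' q' U' V' t : R) :
  is_derive p t p' -> is_derive q t q' -> is_derive U t U' -> is_derive V t V' ->
  (U' = - (p' * U t - q' * V t))%R -> (V' = - (q' * U t + p' * V t))%R ->
  is_derive (fun t => exp (p t) * (U t * cos (q t) - V t * sin (q t)))%R t 0%R /\
  is_derive (fun t => exp (p t) * (U t * sin (q t) + V t * cos (q t)))%R t 0%R.
Proof.
  intros Hp Hq HU HV EU EV.
  assert (Ep : ex_derive p t) by (eexists; eauto).
  assert (Eq : ex_derive q t) by (eexists; eauto).
  assert (EU' : ex_derive U t) by (eexists; eauto).
  assert (EV' : ex_derive V t) by (eexists; eauto).
  apply is_derive_unique in Hp. apply is_derive_unique in Hq.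
  apply is_derive_unique in HU. apply is_derive_unique in HV.
  split; auto_derive; try (repeat split; assumption);
    change (Derive (fun x => p x) t) with (Derive p t);
    change (Derive (fun x => q x) t) with (Derive q t);
    change (Derive (fun x => U x) t) with (Derive U t);
    change (Derive (fun x => V x) t) with (Derive V t);
    rewrite Hp, Hq, HU, HV, EU, EV; ring.
Qed.

Lemma Rbar_lt_1_CV_radius (u : nat -> R) (M r : R) : (0 <= r < 1)%R ->
  (forall k, (Rabs (u k) <= M * r ^ k)%R) -> Rbar_lt 1 (CV_radius u).
Proof.
  intros Hr Hu.
  assert (M0 : (0 <= M)%R).
  { pose proof (Hu O). pose proof (Rabs_pos (u O)). simpl in H. lra. }
  (* A radius above 1 whose product with r is at most 1, also when r = 0. *)
  apply Rbar_lt_le_trans with (Finite (2 / (1 + r))).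
  - simpl. apply Rlt_div_r; lra.
  - apply (proj1 (CV_radius_bounded u)). exists M. intros k.
    rewrite Rabs_mult, <- RPow_abs, (Rabs_pos_eq (2 / (1 + r))) by (apply Rle_mult_inv_pos; lra).
    assert (Hq : (0 <= 2 / (1 + r))%R) by (apply Rle_mult_inv_pos; lra).
    eapply Rle_trans; [apply Rmult_le_compat_r; [apply pow_le, Hq | apply Hu] | ].
    rewrite Rmult_assoc, <- Rpow_mult_distr.
    rewrite <- (Rmult_1_r M) at 2. apply Rmult_le_compat_l; auto.
    eapply Rle_trans; [apply (pow_incr _ 1%R) | rewrite pow1; lra]. split; [apply Rmult_le_pos; [lra | exact Hq] | ].
    replace (r * (2 / (1 + r)))%R with ((r * 2) / (1 + r))%R by (field; lra).
    apply Rle_div_l; lra.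
Qed.

Lemma pow_coef_bounded (a : C) : (0 < Re a)%R -> exists M, forall k, (Cmod (pow_coef a k) <= M)%R.
Proof.
  intros Ha. destruct (pow_coef_decay a Ha) as [M HM].
  exists (Rmax 1 M). intros [ | k].
  - cbn [pow_coef]. rewrite Cmod_1. apply Rmax_l.
  - eapply Rle_trans; [ | apply Rmax_r]. eapply Rle_trans; [ | apply (HM (S k))].
    assert (1 <= INR (S k))%R by (apply (le_INR 1); lia).
    pose proof (Cmod_ge_0 (pow_coef a (S k))). nra.
Qed.

(* Along the segment [t z], the series [psi] solves [(1 - t z) psi' = - a z psi], so that
   [psi * (1 - t z)^(-a)] is constant. *)
Lemma pow_series_eq (a z : C) : (0 < Re a)%R -> (Cmod z < 1)%R ->
  exists U V : R,
    is_series (fun k => Re (pow_coef a k * z ^ k)) U /\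
    is_series (fun k => Im (pow_coef a k * z ^ k)) V /\
    Cpower (1 - z) a = (U, V).
Proof.
  intros Ha Hz.
  set (u := fun k => Re (pow_coef a k * z ^ k)). set (v := fun k => Im (pow_coef a k * z ^ k)).
  destruct (pow_coef_bounded a Ha) as [M HM].
  assert (Hc : forall k, (Cmod (pow_coef a k * z ^ k) <= M * Cmod z ^ k)%R).
  { intros k. rewrite Cmod_mult, Cmod_pow. apply Rmult_le_compat_r; [apply pow_le, Cmod_ge_0 | apply HM]. }
  (* A radius strictly above 1 makes the closed segment 0 <= t <= 1 interior, so that the series can
     be differentiated up to t = 1. *)
  assert (Ru : Rbar_lt 1 (CV_radius u)).
  { apply (Rbar_lt_1_CV_radius u M (Cmod z)); [split; [apply Cmod_ge_0 | auto] | ].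
    intros k. eapply Rle_trans; [apply re_le_Cmod | apply Hc]. }
  assert (Rv : Rbar_lt 1 (CV_radius v)).
  { apply (Rbar_lt_1_CV_radius v M (Cmod z)); [split; [apply Cmod_ge_0 | auto] | ].
    intros k. eapply Rle_trans; [ | apply Hc]. unfold v.
    eapply Rle_trans; [ | apply Rmax_Cmod]. apply Rmax_r. }
  set (U := PSeries u). set (V := PSeries v).
  destruct z as [x y]. destruct a as [al be].
  assert (Hx : (Rabs x < 1)%R) by (eapply Rle_lt_trans; [apply (re_le_Cmod (x, y)) | exact Hz]).
  apply Rabs_def2 in Hx.
  assert (Hin : forall t, (0 <= t <= 1)%R -> Rbar_lt (Rabs t) (CV_radius u) /\ Rbar_lt (Rabs t) (CV_radius v)).
  { intros t Ht. rewrite Rabs_pos_eq by lra.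
    split; (eapply Rbar_le_lt_trans; [ | eassumption]); simpl; lra. }
  assert (Hw : forall t, (0 <= t <= 1)%R -> (0 < 1 - t * x)%R) by (intros t Ht; nra).
  (* [N2] is |1 - t z|^2, and [L] and [A] below are the real and imaginary parts of log(1 - t z). *)
  set (N2 := fun t => ((1 - t * x) ^ 2 + (- (t * y)) ^ 2)%R).
  assert (HN : forall t, (0 <= t <= 1)%R -> (0 < N2 t)%R).
  { intros t Ht. specialize (Hw t Ht). unfold N2. nra. }
  set (L := fun t => (/ 2 * ln (N2 t))%R). set (A := fun t => atan (- (t * y) / (1 - t * x))).
  assert (DL : forall t, (0 <= t <= 1)%R -> is_derive L t (- (x * (1 - t * x) - t * y ^ 2) / N2 t)%R).
  { intros t Ht. pose proof (HN t Ht) as Hn. unfold L, N2 in *. auto_derive; [simpl in Hn; lra | ].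
    field. simpl in Hn. lra. }
  assert (DA : forall t, (0 <= t <= 1)%R -> is_derive A t (- y / N2 t)%R).
  { intros t Ht. pose proof (HN t Ht) as Hn. pose proof (Hw t Ht) as Hw'. unfold A, N2 in *.
    auto_derive; [lra | ]. field. simpl in Hn. repeat split; nra. }
  (* r + i s = a z; [ODE] below is psi' = t z psi' - a z psi in components, with psi = U + i V. *)
  set (r := (al * x - be * y)%R). set (s := (al * y + be * x)%R).
  assert (ODE : forall t, (0 <= t <= 1)%R ->
    exists U' V', is_derive U t U' /\ is_derive V t V' /\
      (U' = x * (t * U') - y * (t * V') - (r * U t - s * V t))%R /\
      (V' = y * (t * U') + x * (t * V') - (s * U t + r * V t))%R).
  { intros t Ht. destruct (Hin t Ht) as [Iu Iv].
    exists (PSeries (PS_derive u) t), (PSeries (PS_derive v) t).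
    split; [apply is_derive_PSeries, Iu | split; [apply is_derive_PSeries, Iv | ]].
    pose proof (PSeries_correct _ _ (ex_pseries_derive u t Iu)) as Su'.
    pose proof (PSeries_correct _ _ (ex_pseries_derive v t Iv)) as Sv'.
    pose proof (PSeries_correct _ _ (CV_radius_inside u t Iu)) as Su.
    pose proof (PSeries_correct _ _ (CV_radius_inside v t Iv)) as Sv.
    fold U in Su. fold V in Sv.
    pose proof (is_pseries_incr_1 _ _ _ Su') as Su1. pose proof (is_pseries_incr_1 _ _ _ Sv') as Sv1.
    apply (proj1 (is_pseries_R _ _ _)) in Su'.
    apply (proj1 (is_pseries_R _ _ _)) in Sv'.
    apply (proj1 (is_pseries_R _ _ _)) in Su.
    apply (proj1 (is_pseries_R _ _ _)) in Sv.
    apply (proj1 (is_pseries_R _ _ _)) in Su1.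
    apply (proj1 (is_pseries_R _ _ _)) in Sv1.
    assert (Eu : forall k, PS_incr_1 (PS_derive u) k = (INR k * u k)%R).
    { intros [ | k]; [exact (eq_sym (Rmult_0_l _)) | reflexivity]. }
    assert (Ev : forall k, PS_incr_1 (PS_derive v) k = (INR k * v k)%R).
    { intros [ | k]; [exact (eq_sym (Rmult_0_l _)) | reflexivity]. }
    assert (Erec : forall k, INR (S k) * (pow_coef (al, be) (S k) * (x, y) ^ S k) =
       (x, y) * (INR k * (pow_coef (al, be) k * (x, y) ^ k)) -
       ((al, be) * (x, y)) * (pow_coef (al, be) k * (x, y) ^ k)).
    { intros k. rewrite Cmult_assoc, pow_coef_S. simpl Cpow. ring. }
    split.
    - rewrite <- (is_series_unique _ _ Su') at 1. apply is_series_unique.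
      apply (is_series_ext (V := R_NormedModule) (fun k => x * (PS_incr_1 (PS_derive u) k * t ^ k) -
         y * (PS_incr_1 (PS_derive v) k * t ^ k) - (r * (u k * t ^ k) - s * (v k * t ^ k)))%R).
      + intros k. match goal with |- @eq _ ?b ?c => change (@eq R b c) end.
        rewrite Eu, Ev. pose proof (f_equal Re (Erec k)) as E.
        unfold PS_derive. unfold u, v.
        transitivity ((Re (INR (S k) * (pow_coef (al, be) (S k) * (x, y) ^ S k))) * t ^ k)%R.
        * rewrite E. unfold r, s, Re, Im, Cmult, Cminus, Cplus, Copp, RtoC. cbn [fst snd]. ring.
        * unfold Re, Cmult at 1, RtoC. cbn [fst snd]. ring.
      + exact (is_series_minus _ _ _ _ (is_series_minus _ _ _ _
          (is_series_scal_l x _ _ Su1) (is_series_scal_l y _ _ Sv1))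
          (is_series_minus _ _ _ _ (is_series_scal_l r _ _ Su) (is_series_scal_l s _ _ Sv))).
    - rewrite <- (is_series_unique _ _ Sv') at 1. apply is_series_unique.
      apply (is_series_ext (V := R_NormedModule) (fun k => y * (PS_incr_1 (PS_derive u) k * t ^ k) +
         x * (PS_incr_1 (PS_derive v) k * t ^ k) - (s * (u k * t ^ k) + r * (v k * t ^ k)))%R).
      + intros k. match goal with |- @eq _ ?b ?c => change (@eq R b c) end.
        rewrite Eu, Ev. pose proof (f_equal Im (Erec k)) as E.
        unfold PS_derive. unfold u, v.
        transitivity ((Im (INR (S k) * (pow_coef (al, be) (S k) * (x, y) ^ S k))) * t ^ k)%R.
        * rewrite E. unfold r, s, Re, Im, Cmult, Cminus, Cplus, Copp, RtoC. cbn [fst snd]. ring.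
        * unfold Im, Cmult at 1, RtoC. cbn [fst snd]. ring.
      + exact (is_series_minus _ _ _ _ (is_series_plus _ _ _ _
          (is_series_scal_l y _ _ Su1) (is_series_scal_l x _ _ Sv1))
          (is_series_plus _ _ _ _ (is_series_scal_l s _ _ Su) (is_series_scal_l r _ _ Sv))). }
  (* p + i q = -a log(1 - t z), so exp(p + i q) is (1 - t z)^(-a). *)
  set (p := fun t => (- (al * L t - be * A t))%R). set (q := fun t => (- (al * A t + be * L t))%R).
  assert (Hrot : forall t, (0 <= t <= 1)%R ->
     is_derive (fun t => exp (p t) * (U t * cos (q t) - V t * sin (q t)))%R t 0%R /\
     is_derive (fun t => exp (p t) * (U t * sin (q t) + V t * cos (q t)))%R t 0%R).
  { intros t Ht. destruct (ODE t Ht) as (U' & V' & DU & DV & EU & EV).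
    pose proof (HN t Ht) as Hn. pose proof (Hw t Ht) as Hw'.
    pose proof (DL t Ht) as DLt. pose proof (DA t Ht) as DAt.
    set (L' := (- (x * (1 - t * x) - t * y ^ 2) / N2 t)%R) in *.
    set (A' := (- y / N2 t)%R) in *.
    assert (EU1 : ((1 - x * t) * U' + y * t * V' = - (r * U t - s * V t))%R) by lra.
    assert (EV1 : ((1 - x * t) * V' - y * t * U' = - (s * U t + r * V t))%R) by lra.
    apply (is_derive_rotation p q U V (- (al * L' - be * A')) (- (al * A' + be * L')) U' V' t); auto.
    - unfold p. apply (is_derive_opp (fun t => al * L t - be * A t)%R).
      apply (is_derive_minus (fun t => al * L t)%R (fun t => be * A t)%R).
      + exact (is_derive_scal L t al _ DLt).
      + exact (is_derive_scal A t be _ DAt).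
    - unfold q. apply (is_derive_opp (fun t => al * A t + be * L t)%R).
      apply (is_derive_plus (fun t => al * A t)%R (fun t => be * L t)%R).
      + exact (is_derive_scal A t al _ DAt).
      + exact (is_derive_scal L t be _ DLt).
    (* Multiplying (1 - t z) psi' by the conjugate of 1 - t z isolates [U'], at the price of the
       factor [N2 t]. *)
    - apply (Rmult_eq_reg_l (N2 t)); [ | lra].
      transitivity ((1 - t * x) * ((1 - x * t) * U' + y * t * V') - y * t * ((1 - x * t) * V' - y * t * U'))%R;
        [unfold N2; ring | ].
      rewrite EU1, EV1. unfold L', A', r, s. field. lra.
    - apply (Rmult_eq_reg_l (N2 t)); [ | lra].
      transitivity ((1 - t * x) * ((1 - x * t) * V' - y * t * U') + y * t * ((1 - x * t) * U' + y * t * V'))%R;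
        [unfold N2; ring | ].
      rewrite EU1, EV1. unfold L', A', r, s. field. lra. }
  exists (U 1%R), (V 1%R).
  assert (Su : is_series u (U 1%R)).
  { destruct (Hin 1%R) as [Iu _]; [lra | ].
    pose proof (proj1 (is_pseries_R _ _ _) (PSeries_correct _ _ (CV_radius_inside u 1%R Iu))) as Su.
    revert Su. apply is_series_ext. intros k. match goal with |- @eq _ ?b ?c => change (@eq R b c) end.
    rewrite pow1. ring. }
  assert (Sv : is_series v (V 1%R)).
  { destruct (Hin 1%R) as [_ Iv]; [lra | ].
    pose proof (proj1 (is_pseries_R _ _ _) (PSeries_correct _ _ (CV_radius_inside v 1%R Iv))) as Sv.
    revert Sv. apply is_series_ext. intros k. match goal with |- @eq _ ?b ?c => change (@eq R b c) end.
    rewrite pow1. ring. }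
  split; [exact Su | split; [exact Sv | ]].
  assert (C1 : (exp (p 1) * (U 1 * cos (q 1) - V 1 * sin (q 1)) = 1)%R /\
               (exp (p 1) * (U 1 * sin (q 1) + V 1 * cos (q 1)) = 0)%R).
  { assert (L0 : L 0%R = 0%R).
    { unfold L, N2. replace ((1 - 0 * x) ^ 2 + (- (0 * y)) ^ 2)%R with 1%R by ring. rewrite ln_1. ring. }
    assert (A0 : A 0%R = 0%R).
    { unfold A. replace (- (0 * y) / (1 - 0 * x))%R with 0%R by field. apply atan_0. }
    assert (p0 : p 0%R = 0%R) by (unfold p; rewrite L0, A0; ring).
    assert (q0 : q 0%R = 0%R) by (unfold q; rewrite L0, A0; ring).
    assert (U0 : U 0%R = 1%R).
    { unfold U. rewrite PSeries_0. unfold u. cbn [pow_coef Cpow]. unfold Re, Cmult; simpl. ring. }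
    assert (V0 : V 0%R = 0%R).
    { unfold V. rewrite PSeries_0. unfold v. cbn [pow_coef Cpow]. unfold Im, Cmult; simpl. ring. }
    split.
    - rewrite <- (eq_is_derive (V := R_NormedModule)
        (fun t => exp (p t) * (U t * cos (q t) - V t * sin (q t)))%R 0%R 1%R).
      + rewrite p0, q0, U0, V0, exp_0, cos_0, sin_0. ring.
      + intros t Ht. apply (Hrot t Ht).
      + lra.
    - rewrite <- (eq_is_derive (V := R_NormedModule)
        (fun t => exp (p t) * (U t * sin (q t) + V t * cos (q t)))%R 0%R 1%R).
      + rewrite p0, q0, U0, V0, exp_0, cos_0, sin_0. ring.
      + intros t Ht. apply (Hrot t Ht).
      + lra. }
  assert (Hlog : Clog (1 - (x, y)) = (L 1%R, A 1%R)).
  { unfold Clog. rewrite Carg_atan by (unfold Re; simpl; lra).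
    replace (1 - (x, y)) with ((1 - 1 * x)%R, (- (1 * y))%R)
      by (unfold Cminus, Cplus, Copp, RtoC; simpl; f_equal; ring).
    rewrite ln_Cmod by (apply (HN 1%R); lra). unfold Re, Im; cbn [fst snd]. reflexivity. }
  assert (Hinv : Cexp (- ((al, be) * (L 1%R, A 1%R))) * (U 1%R, V 1%R) = 1).
  { destruct C1 as [E1 E2]. unfold Cexp.
    replace (Re (- ((al, be) * (L 1%R, A 1%R)))) with (p 1%R) by (unfold p, Re, Copp, Cmult; cbn [fst snd]; ring).
    replace (Im (- ((al, be) * (L 1%R, A 1%R)))) with (q 1%R) by (unfold q, Im, Copp, Cmult; cbn [fst snd]; ring).
    unfold Cmult, RtoC; cbn [fst snd]. f_equal; [etransitivity; [ | exact E1] | etransitivity; [ | exact E2]]; ring. }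
  unfold Cpower. rewrite Hlog.
  rewrite <- (Cmult_1_r (Cexp _)), <- Hinv, Cmult_assoc, <- Cexp_plus.
  rewrite Cplus_opp_r, Cexp_0. apply Cmult_1_l.
Qed.

(** * The normal equations *)

Lemma Cmult_cancel_l (c x y : C) : c <> 0 -> c * x = c * y -> x = y.
Proof.
  intros Hc H. replace x with (/ c * (c * x)) by (field; auto). rewrite H. field. auto.
Qed.

(** * Finite sums and finite differences *)

(** [sum_n] with its type fixed to [C], so that the equations below are stated with the operations
    that [ring] and [field] recognise. *)
Definition Csum (u : nat -> C) (n : nat) : C := sum_n u n.

(* The [n]-th finite difference of [P] at 0, divided by [(-1)^n n!]. *)
Definition fin_diff (n : nat) (P : nat -> C) : C :=
  Csum (fun j => (-1) ^ j / (INR (fact j) * INR (fact (n - j))) * P j) n.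

Lemma Csum_O (u : nat -> C) : Csum u 0 = u O.
Proof. exact (sum_O (G := C_AbelianMonoid) u). Qed.

Lemma Csum_ext_loc (u v : nat -> C) (n : nat) :
  (forall k, (k <= n)%nat -> u k = v k) -> Csum u n = Csum v n.
Proof. exact (sum_n_ext_loc (G := C_AbelianMonoid) u v n). Qed.

Lemma Csum_ext (u v : nat -> C) (n : nat) : (forall k, u k = v k) -> Csum u n = Csum v n.
Proof. intros H. apply Csum_ext_loc. auto. Qed.

Lemma Csum_S (u : nat -> C) (n : nat) : Csum u (S n) = Csum u n + u (S n).
Proof. exact (sum_Sn (G := C_AbelianMonoid) u n). Qed.

Lemma Csum_mult_l (c : C) (u : nat -> C) (n : nat) : Csum (fun k => c * u k) n = c * Csum u n.
Proof. exact (sum_n_mult_l (K := C_Ring) c u n). Qed.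

Lemma Csum_plus (u v : nat -> C) (n : nat) : Csum (fun k => u k + v k) n = Csum u n + Csum v n.
Proof. exact (sum_n_plus (G := C_AbelianMonoid) u v n). Qed.

Lemma Csum_S_l (u : nat -> C) (n : nat) : Csum u (S n) = u O + Csum (fun j => u (S j)) n.
Proof.
  induction n as [ | n IH].
  - rewrite Csum_S, !Csum_O. reflexivity.
  - rewrite Csum_S, IH, (Csum_S (fun j => u (S j))). ring.
Qed.

Lemma fin_diff_ext (n : nat) (P Q : nat -> C) :
  (forall j, (j <= n)%nat -> P j = Q j) -> fin_diff n P = fin_diff n Q.
Proof. intros H. apply Csum_ext_loc. intros j Hj. now rewrite H. Qed.

Lemma fin_diff_plus (n : nat) (P Q : nat -> C) :
  fin_diff n (fun j => P j + Q j) = fin_diff n P + fin_diff n Q.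
Proof.
  unfold fin_diff. rewrite <- Csum_plus. apply Csum_ext. intros j. ring.
Qed.

Lemma fin_diff_scal (n : nat) (c : C) (P : nat -> C) :
  fin_diff n (fun j => c * P j) = c * fin_diff n P.
Proof.
  unfold fin_diff. rewrite <- Csum_mult_l. apply Csum_ext. intros j. ring.
Qed.

Lemma fin_diff_S_index (n : nat) (P : nat -> C) :
  fin_diff (S n) (fun j => INR j * P j) = - fin_diff n (fun j => P (S j)).
Proof.
  unfold fin_diff. rewrite Csum_S_l. simpl INR at 3. rewrite Cmult_0_l, Cmult_0_r, Cplus_0_l.
  replace (- Csum _ n) with (-1 * Csum (fun j => (-1) ^ j / (INR (fact j) * INR (fact (n - j))) * P (S j)) n)
    by ring.
  rewrite <- Csum_mult_l. apply Csum_ext. intros j.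
  rewrite Nat.sub_succ, (fact_simpl j), mult_INR, RtoC_mult. cbn [Cpow].
  field. repeat split; try apply INR_fact_C. apply RtoC_INR_S_neq_0.
Qed.

Lemma fin_diff_S_coindex (n : nat) (P : nat -> C) :
  fin_diff (S n) (fun j => (INR (S n) - INR j) * P j) = fin_diff n P.
Proof.
  unfold fin_diff. rewrite Csum_S.
  replace (INR (S n) - INR (S n)) with (RtoC 0) by ring.
  rewrite Cmult_0_l, Cmult_0_r, Cplus_0_r. apply Csum_ext_loc. intros j Hj.
  rewrite Nat.sub_succ_l, fact_simpl, mult_INR, RtoC_mult by auto.
  replace (INR (S n) - INR j) with (RtoC (INR (S (n - j))))
    by (rewrite <- RtoC_minus, <- minus_INR, Nat.sub_succ_l by lia; reflexivity).
  field. repeat split; try apply INR_fact_C. apply RtoC_INR_S_neq_0.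
Qed.

(** Split n + 1 = (n + 1 - j) + j: the first part cancels into (n + 1 - j)!, the second into j! with
    a shift of the index. *)
Lemma fin_diff_S (n : nat) (P : nat -> C) :
  INR (S n) * fin_diff (S n) P = fin_diff n P - fin_diff n (fun j => P (S j)).
Proof.
  rewrite <- (fin_diff_S_coindex n P). unfold Cminus. rewrite <- (fin_diff_S_index n P).
  rewrite <- fin_diff_plus, <- fin_diff_scal. apply fin_diff_ext. intros j _. ring.
Qed.

(** Polynomials as products of affine factors and a constant, the form in which rising factorials
    come; an induction then treats one factor at a time. *)
Inductive poly_deg_le : nat -> (nat -> C) -> Prop :=
  | poly_deg_const d c P : (forall j, P j = c) -> poly_deg_le d P
  | poly_deg_linear d x y P Q : poly_deg_le d Q -> (forall j, P j = (x + y * INR j) * Q j) ->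
      poly_deg_le (S d) P.

Lemma poly_deg_le_ext (d : nat) (P Q : nat -> C) :
  (forall j, P j = Q j) -> poly_deg_le d P -> poly_deg_le d Q.
Proof.
  intros E H. revert Q E. destruct H as [d' c P' HP | d' x y P' Q' HQ HP]; intros Q E.
  - apply (poly_deg_const d' c). intros j. rewrite <- E. apply HP.
  - apply (poly_deg_linear d' x y _ Q' HQ). intros j. rewrite <- E. apply HP.
Qed.

Lemma poly_deg_le_shift (d : nat) (P : nat -> C) : poly_deg_le d P -> poly_deg_le d (fun j => P (S j)).
Proof.
  induction 1 as [d c P HP | d x y P Q HQ IH HP].
  - apply (poly_deg_const d c). intros j. apply HP.
  - apply (poly_deg_linear d (x + y) y _ _ IH). intros j. rewrite HP, RtoC_S. ring.
Qed.

(** Split off an affine factor x + y j: the part with x has smaller degree, and for the part with y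
    j [fin_diff_S_index] lowers the order of the difference together with the degree. *)
Lemma fin_diff_poly (d : nat) (P : nat -> C) :
  poly_deg_le d P -> forall n, (d < n)%nat -> fin_diff n P = 0.
Proof.
  intros H. assert (Hs : forall n, (d < n)%nat -> forall P, poly_deg_le d P -> fin_diff n P = 0); [ | eauto].
  clear P H. induction d as [ | d IH]; intros n Hn P HP.
  - destruct n as [ | n]; [lia | ].
    inversion HP as [d' c P' Hc | ]; subst.
    assert (E : INR (S n) * fin_diff (S n) P = 0).
    { rewrite fin_diff_S.
      rewrite (fin_diff_ext n (fun j => P (S j)) P) by (intros; rewrite !Hc; reflexivity). ring. }
    replace (fin_diff (S n) P) with (/ INR (S n) * (INR (S n) * fin_diff (S n) P))
      by (field; apply RtoC_INR_S_neq_0).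
    rewrite E. ring.
  - destruct n as [ | n]; [lia | ].
    inversion HP as [d' c P' Hc | d' x y P' Q HQ HPQ]; subst.
    + apply IH; [lia | ]. apply (poly_deg_const d c), Hc.
    + rewrite (fin_diff_ext _ P (fun j => x * Q j + y * (INR j * Q j)))
        by (intros; rewrite HPQ; ring).
      rewrite fin_diff_plus, !fin_diff_scal, fin_diff_S_index.
      rewrite (IH (S n)) by (auto; lia).
      rewrite (IH n) by (try lia; apply poly_deg_le_shift, HQ). ring.
Qed.

Lemma poly_deg_le_rising (x y : C) (r d : nat) (Q : nat -> C) :
  poly_deg_le d Q -> poly_deg_le (r + d) (fun j => rising (x + y * INR j) r * Q j).
Proof.
  intros HQ. induction r as [ | r IH]; simpl.
  - apply (poly_deg_le_ext d Q); auto. intros j. ring.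
  - apply (poly_deg_linear _ (x + INR r) y _ _ IH). intros j. ring.
Qed.

Lemma rising_neq_0 (z : C) (k : nat) : (0 < Re z)%R -> rising z k <> 0.
Proof.
  intros Hz. induction k as [ | k IH]; simpl.
  - intros H. apply RtoC_inj in H. lra.
  - apply Cmult_neq_0; auto. apply Cneq_0_of_Re_pos, Re_plus_INR, Hz.
Qed.

Lemma rising_S_l (z : C) (k : nat) : rising z (S k) = z * rising (z + 1) k.
Proof.
  induction k as [ | k IH].
  - simpl. ring.
  - change (rising z (S (S k))) with (rising z (S k) * (z + INR (S k))).
    rewrite IH, RtoC_S. simpl rising. ring.
Qed.

(** The partial fraction expansion of 1 / (a (a + 1) ... (a + n)). *)
Lemma fin_diff_inv_linear (n : nat) (a : C) : (0 < Re a)%R ->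
  fin_diff n (fun j => / (a + INR j)) = / rising a (S n).
Proof.
  revert a. induction n as [ | n IH]; intros a Ha.
  - unfold fin_diff. rewrite Csum_O. simpl.
    assert (a <> 0) by (apply Cneq_0_of_Re_pos, Ha). rewrite Cplus_0_r. field. auto.
  - assert (Ha1 : (0 < Re (a + 1))%R) by (unfold Re in *; simpl; lra).
    pose proof (fin_diff_S n (fun j => / (a + INR j))) as E. cbv beta in E.
    rewrite (fin_diff_ext n (fun j => / (a + INR (S j))) (fun j => / (a + 1 + INR j))) in E
      by (intros; rewrite RtoC_S; f_equal; ring).
    rewrite !IH in E by auto.
    pose proof (rising_neq_0 a (S (S n)) Ha) as N2.
    pose proof (rising_neq_0 a (S n) Ha) as N1.
    pose proof (rising_neq_0 (a + 1) (S n) Ha1) as N3.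
    assert (N4 : a <> 0) by (apply Cneq_0_of_Re_pos, Ha).
    assert (N5 : a + INR (S n) <> 0) by (apply Cneq_0_of_Re_pos, Re_plus_INR, Ha).
    assert (R2 : rising (a + 1) (S n) = rising a (S n) * (a + INR (S n)) / a).
    { pose proof (rising_S_l a (S n)) as H.
      change (rising a (S (S n))) with (rising a (S n) * (a + INR (S n))) in H.
      rewrite H. field. auto. }
    replace (fin_diff (S n) (fun j => / (a + INR j)))
      with (/ INR (S n) * (INR (S n) * fin_diff (S n) (fun j => / (a + INR j))))
      by (field; apply RtoC_INR_S_neq_0).
    rewrite E, R2.
    change (rising a (S (S n))) with (rising a (S n) * (a + INR (S n))).
    field. repeat split; auto. apply RtoC_INR_S_neq_0.
Qed.

(** The rising factorial may be replaced by its value at j = -a: since x - j + r = (x + a + r) - (a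
    + j), the last term cancels the denominator and leaves a polynomial of degree r, killed as long
    as r < n. *)
Lemma fin_diff_rising_div (n r : nat) (a x : C) : (0 < Re a)%R -> (r <= n)%nat ->
  fin_diff n (fun j => rising (x - INR j) r * / (a + INR j)) = rising (x + a) r / rising a (S n).
Proof.
  intros Ha. induction r as [ | r IH]; intros Hr.
  - rewrite (fin_diff_ext n _ (fun j => / (a + INR j))) by (intros; cbn [rising]; ring).
    rewrite fin_diff_inv_linear by auto. cbn [rising]. unfold Cdiv. ring.
  - rewrite (fin_diff_ext n _ (fun j => (x + a + INR r) * (rising (x - INR j) r * / (a + INR j)) +
       -1 * rising (x - INR j) r)).
    + rewrite fin_diff_plus, !fin_diff_scal, IH by lia.
      rewrite (fin_diff_poly r).
      * cbn [rising]. unfold Cdiv. ring.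
      * replace r with (r + 0)%nat at 1 by lia.
        apply (poly_deg_le_ext _ (fun j => rising (x + -1 * INR j) r * 1)).
        -- intros j. rewrite Cmult_1_r. f_equal. ring.
        -- apply (poly_deg_le_rising x (-1) r 0 (fun _ => 1)), (poly_deg_const 0 1). reflexivity.
      * lia.
    + intros j Hj. cbn [rising]. field. apply Cneq_0_of_Re_pos, Re_plus_INR, Ha.
Qed.

(** * Gram entries and their sums against the claimed coefficients *)

Fixpoint gram_coef (a : C) (m : nat) : C :=
  match m with
  | O => 1
  | S m => gram_coef a m * ((INR m - Cconj a) / (a + INR m + 1))
  end.

(* [<z^j f, z^k f> / |f|^2] *)
Definition gram (a : C) (j k : nat) : C :=
  if le_dec k j then gram_coef a (j - k) else Cconj (gram_coef a (k - j)).

Lemma Re_plus_INR_1 (a : C) (m : nat) : (0 < Re a)%R -> (0 < Re (a + INR m + 1))%R.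
Proof. intros Ha. pose proof (pos_INR m). unfold Re in *; simpl. lra. Qed.

Lemma gram_coef_S (a : C) (m : nat) : (0 < Re a)%R ->
  (a + INR m + 1) * gram_coef a (S m) = (INR m - Cconj a) * gram_coef a m.
Proof.
  intros Ha. cbn [gram_coef]. field. apply Cneq_0_of_Re_pos, Re_plus_INR_1, Ha.
Qed.

(** One recurrence in j on both sides of the diagonal: for j < k the entry is a conjugate, and the
    conjugated recurrence of [gram_coef], read backwards, takes the same form. This is what allows a
    single closed form in [gram_product]. *)
Lemma gram_S (a : C) (j k : nat) : (0 < Re a)%R ->
  (a + INR j - INR k + 1) * gram a (S j) k = (INR j - INR k - Cconj a) * gram a j k.
Proof.
  intros Ha. unfold gram. destruct (le_dec k j) as [H | H].
  - destruct (le_dec k (S j)) as [_ | H']; [ | lia].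
    replace (S j - k)%nat with (S (j - k)) by lia.
    replace (a + INR j - INR k + 1) with (a + INR (j - k) + 1) by (rewrite minus_INR, RtoC_minus by auto; ring).
    replace (INR j - INR k - Cconj a) with (INR (j - k) - Cconj a) by (rewrite minus_INR, RtoC_minus by auto; ring).
    apply gram_coef_S, Ha.
  - set (l := (k - S j)%nat).
    assert (Ek : RtoC (INR k) = INR j + INR l + 1).
    { replace k with (j + S l)%nat by (unfold l; lia). rewrite plus_INR, RtoC_plus, RtoC_S. ring. }
    replace (k - j)%nat with (S l) by (unfold l; lia).
    assert (E1 : (if le_dec k (S j) then gram_coef a (S j - k) else Cconj (gram_coef a l)) = Cconj (gram_coef a l)).
    { destruct (le_dec k (S j)) as [H' | H']; auto.
      replace (S j - k)%nat with O by lia. replace l with O by (unfold l; lia).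
      cbn [gram_coef]. symmetry. apply Cconj_RtoC. }
    rewrite E1, Ek.
    pose proof (f_equal Cconj (gram_coef_S a l Ha)) as E.
    rewrite !Cmult_conj, !Cplus_conj, !Cminus_conj, !Cconj_RtoC, Cconj_conj in E.
    transitivity (- ((INR l - a) * Cconj (gram_coef a l))); [ring | ].
    rewrite <- E. ring.
Qed.

(* Both sides satisfy the same first-order recurrence in [j], which is run up and down from [j = k]. *)
Lemma gram_product (a : C) (n k : nat) (A : nat -> C) : (0 < Re a)%R -> (k <= n)%nat ->
  (forall j, (a + INR j - INR k + 1) * A (S j) = (a + INR j) * A j) ->
  a * A k = rising a k ->
  forall j, (j <= n)%nat ->
    rising a j * rising (Cconj a) (S (n - j)) * gram a j k =
    a * Cconj a * (-1) ^ k * (-1) ^ j * (A j * rising (Cconj a + 1 + INR k - INR j) (n - k)).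
Proof.
  intros Ha Hk HA HAk.
  set (b := Cconj a). assert (Hb : (0 < Re b)%R) by (unfold b; rewrite re_conj; auto).
  set (E := fun j => rising a j * rising b (S (n - j)) * gram a j k).
  set (F := fun j => a * b * (-1) ^ k * (-1) ^ j * (A j * rising (b + 1 + INR k - INR j) (n - k))).
  assert (Hm1 : forall i : nat, (-1) ^ i * (-1) ^ i = 1).
  { intros i. rewrite <- Cpow_mult_l. replace (-1 * -1) with (RtoC 1) by ring. apply Cpow_1_l. }
  assert (HE : forall j, (j < n)%nat ->
    (b + INR n - INR j) * (a + INR j - INR k + 1) * E (S j) = (a + INR j) * (INR j - INR k - b) * E j).
  { intros j Hj. unfold E. pose proof (gram_S a j k Ha) as G.
    replace (n - j)%nat with (S (n - S j)) by lia.
    change (rising b (S (S (n - S j)))) with (rising b (S (n - S j)) * (b + INR (S (n - S j)))).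
    replace (S (n - S j)) with (n - j)%nat at 3 by lia.
    rewrite minus_INR, RtoC_minus by lia.
    change (rising a (S j)) with (rising a j * (a + INR j)).
    transitivity (rising a j * (a + INR j) * rising b (S (n - S j)) * (b + INR n - INR j) *
      ((a + INR j - INR k + 1) * gram a (S j) k)); [ring | ].
    rewrite G. fold b. ring. }
  assert (HF : forall j, (j < n)%nat ->
    (b + INR n - INR j) * (a + INR j - INR k + 1) * F (S j) = (a + INR j) * (INR j - INR k - b) * F j).
  { intros j Hj. unfold F. set (y := b + INR k - INR j).
    replace (b + 1 + INR k - INR (S j)) with y by (unfold y; rewrite RtoC_S; ring).
    replace (b + 1 + INR k - INR j) with (y + 1) by (unfold y; ring).
    pose proof (rising_S_l y (n - k)) as Hr.
    change (rising y (S (n - k))) with (rising y (n - k) * (y + INR (n - k))) in Hr.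
    rewrite minus_INR, RtoC_minus in Hr by auto.
    replace (y + (INR n - INR k)) with (b + INR n - INR j) in Hr by (unfold y; ring).
    cbn [Cpow].
    transitivity (- (a * b * (-1) ^ k * (-1) ^ j) * ((a + INR j - INR k + 1) * A (S j)) *
       (rising y (n - k) * (b + INR n - INR j))); [ring | ].
    rewrite HA, Hr. unfold y. ring. }
  assert (Hbase : E k = F k).
  { unfold E, F, gram. destruct (le_dec k k) as [_ | H]; [ | lia].
    rewrite Nat.sub_diag. cbn [gram_coef].
    replace (b + 1 + INR k - INR k) with (b + 1) by ring.
    rewrite rising_S_l, <- HAk.
    transitivity (a * b * ((-1) ^ k * (-1) ^ k) * (A k * rising (b + 1) (n - k))); [ | ring].
    rewrite Hm1. ring. }
  (* Upwards one divides by a + j - k + 1 with j >= k and by conj a + n - j with j < n, downwards by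
     a + j and by j - k - conj a with j < k; none of these vanishes because Re a > 0. *)
  assert (Hup : forall m, (k + m <= n)%nat -> E (k + m)%nat = F (k + m)%nat).
  { induction m as [ | m IH]; intros Hm.
    - rewrite Nat.add_0_r. exact Hbase.
    - rewrite Nat.add_succ_r. specialize (IH ltac:(lia)).
      pose proof (HE (k + m)%nat ltac:(lia)) as X. rewrite IH, <- HF in X by lia.
      refine (Cmult_cancel_l _ _ _ _ X). apply Cmult_neq_0; apply Cneq_0_of_Re_pos.
      + assert (INR (k + m) <= INR n)%R by (apply le_INR; lia). unfold Re in *; simpl. lra.
      + rewrite plus_INR. pose proof (pos_INR m). unfold Re in *; simpl. lra. }
  assert (Hdown : forall m, (m <= k)%nat -> E (k - m)%nat = F (k - m)%nat).
  { induction m as [ | m IH]; intros Hm.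
    - rewrite Nat.sub_0_r. exact Hbase.
    - specialize (IH ltac:(lia)). set (j := (k - S m)%nat) in *.
      replace (k - m)%nat with (S j) in IH by (unfold j; lia).
      pose proof (HE j ltac:(lia)) as X. rewrite IH, HF in X by lia. symmetry in X.
      refine (Cmult_cancel_l _ _ _ _ X). apply Cmult_neq_0.
      + apply Cneq_0_of_Re_pos, Re_plus_INR, Ha.
      + replace (INR j - INR k - b) with (- (b + (INR k - INR j))) by ring.
        intros Z. apply (Cneq_0_of_Re_pos (b + (INR k - INR j))).
        * assert (INR j <= INR k)%R by (apply le_INR; lia). unfold Re in *; simpl. lra.
        * replace (b + (INR k - INR j)) with (- - (b + (INR k - INR j))) by ring. rewrite Z. ring. }
  intros j Hj. change (E j = F j). destruct (le_dec k j) as [H | H].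
  - replace j with (k + (j - k))%nat by lia. apply Hup. lia.
  - replace j with (k - (k - j))%nat by lia. apply Hdown. lia.
Qed.

(** The claimed coefficient up to a factor independent of j, once the Gammas are reduced by the
    functional equation; the second quotient comes from 1 / B(n - j + 1, conj a). *)
Definition opt_coef (a : C) (n j : nat) : C :=
  rising a j / INR (fact j) * (rising (Cconj a) (S (n - j)) / INR (fact (n - j))).

Lemma opt_coef_gram_0 (a : C) (n : nat) : (0 < Re a)%R ->
  Csum (fun j => opt_coef a n j * gram a j 0) n =
  a * Cconj a * (rising (a + Cconj a + 1) n / rising a (S n)).
Proof.
  intros Ha.
  replace (rising (a + Cconj a + 1) n) with (rising (Cconj a + 1 + a) n) by (f_equal; ring).
  rewrite <- fin_diff_rising_div by auto.
  rewrite <- fin_diff_scal. apply Csum_ext_loc. intros j Hj.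
  (* The sequence [A] of [gram_product] stands for Gamma(a + j) / Gamma(a + j - k + 1). For k = 0
     this is 1 / (a + j), which is not a polynomial. *)
  pose proof (gram_product a n 0 (fun j => / (a + INR j)) Ha ltac:(lia)) as H.
  assert (N : forall j, a + INR j <> 0) by (intros; apply Cneq_0_of_Re_pos, Re_plus_INR, Ha).
  specialize (H ltac:(intros i; replace (a + INR i - INR 0 + 1) with (a + INR (S i))
    by (rewrite RtoC_S; simpl; ring); field; split; apply N)).
  specialize (H ltac:(simpl; rewrite Cplus_0_r; field; apply Cneq_0_of_Re_pos, Ha) j Hj).
  rewrite Nat.sub_0_r in H.
  replace (Cconj a + 1 + INR 0 - INR j) with (Cconj a + 1 - INR j) in H by (simpl; ring).
  transitivity (/ (INR (fact j) * INR (fact (n - j))) *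
    (rising a j * rising (Cconj a) (S (n - j)) * gram a j 0)).
  - unfold opt_coef. field. split; apply INR_fact_C.
  - rewrite H. cbn [Cpow]. field. repeat split; try apply INR_fact_C. apply N.
Qed.

Lemma opt_coef_gram_pos (a : C) (n k : nat) : (0 < Re a)%R -> (1 <= k <= n)%nat ->
  Csum (fun j => opt_coef a n j * gram a j k) n = 0.
Proof.
  intros Ha Hk.
  (* Again Gamma(a + j) / Gamma(a + j - k + 1), a polynomial of degree k - 1 in j because k >= 1. *)
  set (A := fun j => rising (a + INR j - INR k + 1) (k - 1)).
  assert (HA : forall j, (a + INR j - INR k + 1) * A (S j) = (a + INR j) * A j).
  { intros j. unfold A. set (x := a + INR j - INR k + 1).
    replace (a + INR (S j) - INR k + 1) with (x + 1) by (unfold x; rewrite RtoC_S; ring).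
    rewrite <- rising_S_l. cbn [rising].
    rewrite minus_INR, RtoC_minus by lia.
    replace (x + (INR k - INR 1)) with (a + INR j) by (unfold x; simpl; ring). ring. }
  assert (HAk : a * A k = rising a k).
  { unfold A. replace (a + INR k - INR k + 1) with (a + 1) by ring.
    rewrite <- rising_S_l. f_equal. lia. }
  set (P := fun j => rising ((a - INR k + 1) + 1 * INR j) (k - 1) *
     (rising ((Cconj a + 1 + INR k) + -1 * INR j) (n - k) * 1)).
  assert (HP : fin_diff n P = 0).
  { apply (fin_diff_poly ((k - 1) + ((n - k) + 0))); [ | lia].
    apply poly_deg_le_rising, poly_deg_le_rising. apply (poly_deg_const 0 1). reflexivity. }
  transitivity ((a * Cconj a * (-1) ^ k) * fin_diff n P); [ | rewrite HP; ring].
  rewrite <- fin_diff_scal. apply Csum_ext_loc. intros j Hj.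
  pose proof (gram_product a n k A Ha ltac:(lia) HA HAk j Hj) as H.
  transitivity (/ (INR (fact j) * INR (fact (n - j))) *
    (rising a j * rising (Cconj a) (S (n - j)) * gram a j k)).
  - unfold opt_coef. field. split; apply INR_fact_C.
  - rewrite H. unfold P, A.
    replace (a - INR k + 1 + 1 * INR j) with (a + INR j - INR k + 1) by ring.
    replace (Cconj a + 1 + INR k + -1 * INR j) with (Cconj a + 1 + INR k - INR j) by ring.
    field. split; apply INR_fact_C.
Qed.

(** * Series of complex numbers *)

Definition Cseries (u : nat -> C) (l : C) : Prop := Clim (Csum u) l.

Lemma is_series_Cseries (u : nat -> C) (l : C) :
  is_series (K := C_AbsRing) (V := C_NormedModule) u l <-> Cseries u l.
Proof.
  unfold is_series. rewrite (filterlim_locally_ball_norm (K := C_AbsRing) (U := C_NormedModule)).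
  unfold Cseries, Clim. rewrite <- is_lim_seq_spec. unfold is_lim_seq'.
  split; intros H eps; specialize (H eps); revert H; apply filter_imp; intros n Hn.
  - rewrite Rminus_0_r, Rabs_pos_eq by apply Cmod_ge_0. exact Hn.
  - rewrite Rminus_0_r, Rabs_pos_eq in Hn by apply Cmod_ge_0. exact Hn.
Qed.

Lemma Cseries_ext (u v : nat -> C) (l : C) : (forall k, u k = v k) -> Cseries u l -> Cseries v l.
Proof. intros H. apply Clim_ext. intros n. apply Csum_ext, H. Qed.

Lemma Clim_plus (u v : nat -> C) (l m : C) : Clim u l -> Clim v m -> Clim (fun n => u n + v n) (l + m).
Proof.
  unfold Clim. intros Hu Hv.
  apply (is_lim_seq_le_le (fun _ => 0%R) _ (fun n => Cmod (u n - l) + Cmod (v n - m))%R).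
  - intros n. split; [apply Cmod_ge_0 | ].
    replace (u n + v n - (l + m)) with ((u n - l) + (v n - m)) by ring. apply Cmod_triangle.
  - apply is_lim_seq_const.
  - replace (Finite 0) with (Finite (0 + 0)) by (f_equal; ring). apply is_lim_seq_plus'; auto.
Qed.

Lemma Cseries_plus (u v : nat -> C) (l m : C) :
  Cseries u l -> Cseries v m -> Cseries (fun k => u k + v k) (l + m).
Proof.
  intros Hu Hv. apply (Clim_ext (fun n => Csum u n + Csum v n)).
  - intros n. symmetry. apply Csum_plus.
  - apply Clim_plus; auto.
Qed.

Lemma Cseries_scal (c : C) (u : nat -> C) (l : C) : Cseries u l -> Cseries (fun k => c * u k) (c * l).
Proof.
  intros Hu. apply (Clim_ext (fun n => c * Csum u n)).
  - intros n. symmetry. apply Csum_mult_l.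
  - apply Clim_mult; [apply Clim_const | exact Hu].
Qed.

Lemma Cseries_Csum (n : nat) (u : nat -> nat -> C) (l : nat -> C) :
  (forall j, (j <= n)%nat -> Cseries (u j) (l j)) ->
  Cseries (fun k => Csum (fun j => u j k) n) (Csum l n).
Proof.
  induction n as [ | n IH]; intros H.
  - rewrite Csum_O. apply (Cseries_ext (u O)); auto. intros k. now rewrite Csum_O.
  - rewrite Csum_S. apply (Cseries_ext (fun k => Csum (fun j => u j k) n + u (S n) k)).
    + intros k. now rewrite Csum_S.
    + apply Cseries_plus; auto.
Qed.

Lemma Clim_incr_1 (u : nat -> C) (l : C) : Clim (fun n => u (S n)) l <-> Clim u l.
Proof. unfold Clim. symmetry. apply (is_lim_seq_incr_1 (fun n => Cmod (u n - l))). Qed.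

Lemma Cseries_decr_1 (u : nat -> C) (l : C) : Cseries (fun k => u (S k)) l -> Cseries u (u O + l).
Proof.
  intros H. apply (proj1 (Clim_incr_1 _ _)). apply (Clim_ext (fun n => u O + Csum (fun k => u (S k)) n)).
  - intros n. symmetry. apply Csum_S_l.
  - apply Clim_plus; [apply Clim_const | exact H].
Qed.

Lemma Cseries_telescope (T : nat -> C) : Clim T 0 -> Cseries (fun k => T (S k) - T k) (- T O).
Proof.
  intros H. apply (Clim_ext (fun n => T (S n) + - T O)).
  - intros n. induction n as [ | n IH].
    + rewrite Csum_O. ring.
    + rewrite Csum_S, <- IH. ring.
  - replace (- T O) with (0 + - T O) at 2 by ring.
    pose proof (Clim_plus _ _ _ _ (proj2 (Clim_incr_1 T 0) H) (Clim_const (- T O))) as L.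
    rewrite Cplus_0_l in L. exact L.
Qed.

Lemma Cseries_RtoC (u : nat -> R) (l : R) : is_series u l -> Cseries (fun k => RtoC (u k)) (RtoC l).
Proof.
  intros H. apply (Clim_ext (fun n => RtoC (sum_n u n))).
  - intros n. induction n as [ | n IH].
    + rewrite Csum_O, sum_O. reflexivity.
    + rewrite Csum_S, <- IH, sum_Sn, <- RtoC_plus. reflexivity.
  - apply Clim_RtoC. exact H.
Qed.

Lemma Re_plus (x y : C) : Re (x + y) = (Re x + Re y)%R. Proof. reflexivity. Qed.

Lemma Cseries_Re (u : nat -> C) (l : C) : Cseries u l -> is_series (fun k => Re (u k)) (Re l).
Proof.
  intros H. change (is_lim_seq (sum_n (fun k => Re (u k))) (Re l)).
  apply (is_lim_seq_ext (fun n => Re l + Re (Csum u n - l))%R).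
  - intros n. rewrite <- Re_plus. replace (l + (Csum u n - l)) with (Csum u n) by ring.
    induction n as [ | n IH].
    + rewrite Csum_O, sum_O. reflexivity.
    + rewrite Csum_S, sum_Sn, <- IH. reflexivity.
  - replace (Finite (Re l)) with (Finite (Re l + 0)) by (f_equal; ring).
    apply is_lim_seq_plus'; [apply is_lim_seq_const | ].
    apply is_lim_seq_abs_0.
    apply (is_lim_seq_le_le (fun _ => 0%R) _ (fun n => Cmod (Csum u n - l))).
    + intros n. split; [apply Rabs_pos | apply re_le_Cmod].
    + apply is_lim_seq_const.
    + exact H.
Qed.

Lemma Cseries_Im (u : nat -> C) (l : C) : Cseries u l -> is_series (fun k => Im (u k)) (Im l).
Proof.
  intros H. apply (Cseries_scal (- Ci)) in H. apply Cseries_Re in H.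
  replace (Im l) with (Re (- Ci * l)) by (unfold Re, Im; simpl; ring).
  revert H. apply is_series_ext. intros k.
  match goal with |- @eq _ ?b ?c => change (@eq R b c) end. unfold Re, Im; simpl; ring.
Qed.

Lemma Cseries_components (u : nat -> C) (x y : R) :
  is_series (fun k => Re (u k)) x -> is_series (fun k => Im (u k)) y -> Cseries u (x, y).
Proof.
  intros Hx Hy. apply Cseries_RtoC in Hx. apply Cseries_RtoC in Hy.
  pose proof (Cseries_plus _ _ _ _ Hx (Cseries_scal Ci _ _ Hy)) as H.
  replace (x, y) with (RtoC x + Ci * RtoC y) by (unfold Cplus, Cmult, Ci, RtoC; simpl; f_equal; ring).
  revert H. apply Cseries_ext. intros k. destruct (u k) as [p q].
  unfold Cplus, Cmult, Ci, RtoC, Re, Im; simpl; f_equal; ring.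
Qed.

Lemma Cseries_conj (u : nat -> C) (l : C) : Cseries u l -> Cseries (fun k => Cconj (u k)) (Cconj l).
Proof.
  intros H. unfold Cconj at 2. apply Cseries_components.
  - exact (Cseries_Re _ _ H).
  - exact (is_series_opp _ _ (Cseries_Im _ _ H)).
Qed.

(** * The Gram matrix of the shifts of [f] *)

(** The coefficients of z^j f when [u] holds those of f. *)
Fixpoint shift (j : nat) (u : nat -> C) (k : nat) : C :=
  match j, k with
  | O, _ => u k
  | S _, O => 0
  | S j, S k => shift j u k
  end.

Lemma Cseries_pow_coef (a : C) (m : nat) : (0 < Re a)%R ->
  Cseries (fun k => pow_coef a k * Cconj (pow_coef a (k + m)))
    (Series (fun k => Cmod (pow_coef a k) ^ 2)%R * gram_coef a m).
Proof.
  intros Ha. set (s := Series _). induction m as [ | m IH].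
  - cbn [gram_coef]. rewrite Cmult_1_r.
    apply (Cseries_ext (fun k => RtoC (Cmod (pow_coef a k) ^ 2))).
    + intros k. rewrite Nat.add_0_r. apply Cmod2_conj.
    + apply Cseries_RtoC, (Series_correct (fun k => Cmod (pow_coef a k) ^ 2)%R), ex_series_pow_coef, Ha.
  (* T_(k+1) - T_k = f_k ((m - conj a) conj f_(k+m) - (a + m + 1) conj f_(k+m+1)), by the recurrence
     at k and at k + m; the sum is -T_0 = 0 since T carries the factor k. *)
  - set (T := fun k => INR k * pow_coef a k * Cconj (pow_coef a (k + m))).
    assert (HT : Clim T 0).
    { destruct (pow_coef_decay a Ha) as [M HM].
      apply (is_lim_seq_le_le (fun _ => 0%R) _ (fun k => M * Cmod (pow_coef a (k + m)))%R).
      - intros k. split; [apply Cmod_ge_0 | ].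
        replace (T k - 0) with (T k) by ring. unfold T.
        rewrite !Cmod_mult, Cmod_conj, Cmod_R, Rabs_pos_eq by apply pos_INR.
        apply Rmult_le_compat_r; [apply Cmod_ge_0 | apply HM].
      - apply is_lim_seq_const.
      - replace (Finite 0) with (Rbar_mult M 0%R) by (simpl; f_equal; ring).
        apply is_lim_seq_scal_l. apply (is_lim_seq_incr_n (fun k => Cmod (pow_coef a k)) m), is_lim_pow_coef, Ha. }
    assert (N : a + INR m + 1 <> 0) by (apply Cneq_0_of_Re_pos, Re_plus_INR_1, Ha).
    pose proof (Cseries_plus _ _ _ _
      (Cseries_scal ((INR m - Cconj a) / (a + INR m + 1)) _ _ IH)
      (Cseries_scal (- / (a + INR m + 1)) _ _ (Cseries_telescope T HT))) as H.
    replace (s * gram_coef a (S m)) with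
      ((INR m - Cconj a) / (a + INR m + 1) * (s * gram_coef a m) + - / (a + INR m + 1) * - T O)
      by (cbn [gram_coef]; unfold T; simpl INR; field; auto).
    revert H. apply Cseries_ext. intros k. unfold T.
    replace (S k + m)%nat with (k + S m)%nat by lia.
    pose proof (pow_coef_S a k) as E1.
    assert (E2 : INR (k + S m) * Cconj (pow_coef a (k + S m)) =
      (INR (k + m) - Cconj a) * Cconj (pow_coef a (k + m))).
    { pose proof (f_equal Cconj (pow_coef_S a (k + m))) as E.
      rewrite Nat.add_succ_r. rewrite !Cmult_conj, Cminus_conj, !Cconj_RtoC in E. exact E. }
    rewrite E1. rewrite !plus_INR, !RtoC_plus, RtoC_S in E2.
    transitivity (/ (a + INR m + 1) * pow_coef a k *
      (- ((INR k - a) * Cconj (pow_coef a (k + S m))) + ((INR k + INR m - Cconj a) * Cconj (pow_coef a (k + m))))).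
    + field. auto.
    + rewrite <- E2. field. auto.
Qed.

Lemma Cseries_shift_right (m : nat) (u v : nat -> C) (l : C) :
  Cseries (fun k => u k * v (k + m)%nat) l -> Cseries (fun k => shift m u k * v k) l.
Proof.
  revert v. induction m as [ | m IH]; intros v H.
  - revert H. apply Cseries_ext. intros k. now rewrite Nat.add_0_r.
  - replace l with (shift (S m) u 0 * v O + l) by (simpl; ring).
    apply (Cseries_decr_1 (fun k => shift (S m) u k * v k)).
    apply (IH (fun k => v (S k))). revert H. apply Cseries_ext. intros k. now rewrite Nat.add_succ_r.
Qed.

Lemma Cseries_shift_both (j k : nat) (u v : nat -> C) (l : C) :
  Cseries (fun i => shift j u i * Cconj (shift k v i)) l ->
  Cseries (fun i => shift (S j) u i * Cconj (shift (S k) v i)) l.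
Proof.
  intros H. replace l with (shift (S j) u 0 * Cconj (shift (S k) v 0) + l) by (simpl; ring).
  apply (Cseries_decr_1 (fun i => shift (S j) u i * Cconj (shift (S k) v i))). exact H.
Qed.

(** Multiplication by z is an isometry, so a common shift can be removed until j or k is 0; the case
    j < k follows by conjugation. *)
Lemma Cseries_gram (a : C) (j k : nat) : (0 < Re a)%R ->
  Cseries (fun i => shift j (pow_coef a) i * Cconj (shift k (pow_coef a) i))
    (Series (fun i => Cmod (pow_coef a i) ^ 2)%R * gram a j k).
Proof.
  intros Ha. set (s := Series _).
  revert k. induction j as [ | j IH]; intros k.
  - destruct k as [ | k].
    + apply (Cseries_shift_right 0 _ (fun i => Cconj (pow_coef a i))). apply (Cseries_pow_coef a 0 Ha).
    + pose proof (Cseries_shift_right (S k) _ (fun i => Cconj (pow_coef a i)) _ (Cseries_pow_coef a (S k) Ha)) as H.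
      apply Cseries_conj in H. rewrite Cmult_conj, Cconj_RtoC in H.
      revert H. apply Cseries_ext. intros i. rewrite Cmult_conj, Cconj_conj. apply Cmult_comm.
  - destruct k as [ | k].
    + apply (Cseries_shift_right (S j) _ (fun i => Cconj (pow_coef a i))). apply (Cseries_pow_coef a (S j) Ha).
    + replace (gram a (S j) (S k)) with (gram a j k).
      * apply Cseries_shift_both, IH.
      * unfold gram. destruct (le_dec k j), (le_dec (S k) (S j)); try lia; reflexivity.
Qed.

(** * Coefficients in H^2 *)

Lemma pow_n_Cpow (z : C) (k : nat) : pow_n (K := C_Ring) z k = z ^ k.
Proof. induction k as [ | k IH]; simpl; [reflexivity | rewrite IH; reflexivity]. Qed.

Lemma is_pseries_Cseries (c : nat -> C) (z l : C) :
  is_pseries (K := C_AbsRing) (V := C_NormedModule) c z l <-> Cseries (fun k => c k * z ^ k) l.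
Proof.
  unfold is_pseries. rewrite is_series_Cseries.
  split; apply Cseries_ext; intros k.
  - transitivity (pow_n (K := C_Ring) z k * c k); [reflexivity | rewrite pow_n_Cpow; ring].
  - symmetry. transitivity (pow_n (K := C_Ring) z k * c k); [reflexivity | rewrite pow_n_Cpow; ring].
Qed.

(** Makes [taylor_coef], an arbitrary choice, computable. On the real segment (-1, 1) the real and
    imaginary parts of the coefficients are those of real power series, to which the real identity
    theorem applies. *)
Lemma power_series_unique (g : C -> C) (c d : nat -> C) :
  power_series_on_disk g c -> power_series_on_disk g d -> forall k, c k = d k.
Proof.
  intros Hc Hd.
  assert (Hz : forall x : R, (Rabs x < 1)%R -> Cseries (fun k => c k * RtoC (x ^ k)) (g (RtoC x)) /\
                                       Cseries (fun k => d k * RtoC (x ^ k)) (g (RtoC x))).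
  { intros x Hx. assert (Hx' : (Cmod (RtoC x) < 1)%R) by (rewrite Cmod_R; auto).
    pose proof (proj1 (is_pseries_Cseries _ _ _) (Hc _ Hx')) as Sc.
    pose proof (proj1 (is_pseries_Cseries _ _ _) (Hd _ Hx')) as Sd.
    split; [revert Sc | revert Sd]; apply Cseries_ext; intros k; now rewrite RtoC_pow. }
  assert (key : forall u v : nat -> R,
    (forall x, (Rabs x < 1)%R -> exists l, is_series (fun k => u k * x ^ k)%R l /\ is_series (fun k => v k * x ^ k)%R l) ->
    forall k, u k = v k).
  { intros u v H k.
    (* Convergence at the single point 1 / 2 already forces a positive radius. *)
    assert (CV : forall w : nat -> R, (exists l, is_series (fun k => w k * (/ 2) ^ k)%R l) ->
      Rbar_lt 0 (CV_radius w)).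
    { intros w [l Hl]. apply Rbar_lt_le_trans with (Finite (/ 2)); [simpl; lra | ].
      destruct (Rbar_le_lt_dec (/ 2)%R (CV_radius w)) as [L | L]; auto. exfalso.
      apply (CV_disk_outside w (/ 2)%R).
      - rewrite Rabs_pos_eq by lra. exact L.
      - apply ex_series_lim_0. exists l. exact Hl. }
    destruct (H (/ 2)%R) as [l [Hu Hv]]; [rewrite Rabs_pos_eq; lra | ].
    apply PSeries_ext_recip.
    - apply CV. exists l. exact Hu.
    - apply CV. exists l. exact Hv.
    - exists (mkposreal 1 Rlt_0_1). intros x Hx.
      destruct (H x) as [lx [Hux Hvx]].
      + unfold ball in Hx; simpl in Hx. unfold AbsRing_ball, abs, minus, plus, opp in Hx; simpl in Hx.
        rewrite Ropp_0, Rplus_0_r in Hx. exact Hx.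
      + rewrite (is_pseries_unique u x lx) by (apply is_pseries_R; exact Hux).
        rewrite (is_pseries_unique v x lx) by (apply is_pseries_R; exact Hvx). reflexivity. }
  intros k. apply injective_projections.
  - apply (key (fun k => fst (c k)) (fun k => fst (d k))). intros x Hx.
    destruct (Hz x Hx) as [Sc Sd]. exists (Re (g x)).
    split; [apply Cseries_Re in Sc; revert Sc | apply Cseries_Re in Sd; revert Sd]; apply is_series_ext;
      intros i; match goal with |- @eq _ ?b ?c => change (@eq R b c) end;
      unfold Re, Cmult, RtoC; cbn [fst snd]; ring.
  - apply (key (fun k => snd (c k)) (fun k => snd (d k))). intros x Hx.
    destruct (Hz x Hx) as [Sc Sd]. exists (Im (g x)).
    split; [apply Cseries_Im in Sc; revert Sc | apply Cseries_Im in Sd; revert Sd]; apply is_series_ext;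
      intros i; match goal with |- @eq _ ?b ?c => change (@eq R b c) end;
      unfold Im, Cmult, RtoC; cbn [fst snd]; ring.
Qed.

Lemma H2_norm_eq (g : C -> C) (c : nat -> C) : power_series_on_disk g c ->
  H2_norm g = sqrt (Series (fun k => Cmod (c k) ^ 2)%R).
Proof.
  intros Hc. unfold H2_norm. f_equal. apply Series_ext. intros k.
  rewrite (power_series_unique g (taylor_coef g) c); auto.
  apply (epsilon_spec (inhabits (fun _ => RtoC 0)) (power_series_on_disk g)). exists c. exact Hc.
Qed.

Definition square_summable (u : nat -> C) : Prop := ex_series (fun k => Cmod (u k) ^ 2)%R.

Lemma square_summable_plus (u v : nat -> C) :
  square_summable u -> square_summable v -> square_summable (fun k => u k + v k).
Proof.
  intros Hu Hv.
  apply (ex_series_le (V := R_CompleteNormedModule) _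
    (fun k => 2 * Cmod (u k) ^ 2 + 2 * Cmod (v k) ^ 2)%R).
  - intros k. unfold norm; simpl. unfold abs; simpl. rewrite !Rmult_1_r.
    pose proof (Cmod_triangle (u k) (v k)). pose proof (Cmod_ge_0 (u k + v k)).
    pose proof (Cmod_ge_0 (u k)). pose proof (Cmod_ge_0 (v k)).
    rewrite Rabs_pos_eq by nra.
    assert (Cmod (u k + v k) * Cmod (u k + v k) <= (Cmod (u k) + Cmod (v k)) * (Cmod (u k) + Cmod (v k)))%R
      by (apply Rmult_le_compat; auto).
    pose proof (pow2_ge_0 (Cmod (u k) - Cmod (v k))). nra.
  - exact (ex_series_plus (V := R_NormedModule) _ _
      (ex_series_scal_l (V := R_NormedModule) 2%R _ Hu) (ex_series_scal_l (V := R_NormedModule) 2%R _ Hv)).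
Qed.

Lemma square_summable_scal (c : C) (u : nat -> C) : square_summable u -> square_summable (fun k => c * u k).
Proof.
  intros Hu. apply (ex_series_ext (V := R_NormedModule) (fun k => Cmod c ^ 2 * Cmod (u k) ^ 2)%R).
  - intros k. match goal with |- @eq _ ?b ?c => change (@eq R b c) end.
    rewrite Cmod_mult. ring.
  - exact (ex_series_scal_l (V := R_NormedModule) _ _ Hu).
Qed.

Lemma square_summable_shift (j : nat) (u : nat -> C) : square_summable u -> square_summable (shift j u).
Proof.
  intros Hu. induction j as [ | j IH]; [exact Hu | ].
  apply (ex_series_incr_1 (V := R_NormedModule) (fun k => Cmod (shift (S j) u k) ^ 2)%R). exact IH.
Qed.

Lemma square_summable_Csum (n : nat) (u : nat -> nat -> C) :
  (forall j, square_summable (u j)) -> square_summable (fun k => Csum (fun j => u j k) n).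
Proof.
  intros H. induction n as [ | n IH].
  - apply (ex_series_ext (V := R_NormedModule) (fun k => Cmod (u O k) ^ 2)%R); [ | apply H].
    intros k. now rewrite Csum_O.
  - apply (ex_series_ext (V := R_NormedModule) (fun k => Cmod (Csum (fun j => u j k) n + u (S n) k) ^ 2)%R).
    + intros k. now rewrite Csum_S.
    + exact (square_summable_plus _ _ IH (H (S n))).
Qed.

(* Coefficients of [p f], [p] having coefficients [c]. *)
Definition poly_mul (n : nat) (c f : nat -> C) (k : nat) : C := Csum (fun j => c j * shift j f k) n.

Definition unit_coef (k : nat) : C := match k with O => 1 | S _ => 0 end.

Lemma square_summable_poly_mul (n : nat) (c f : nat -> C) :
  square_summable f -> square_summable (poly_mul n c f).
Proof.
  intros Hf. apply (square_summable_Csum n (fun j k => c j * shift j f k)).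
  intros j. apply square_summable_scal, square_summable_shift, Hf.
Qed.

Lemma Cseries_0 (u : nat -> C) : (forall k, u k = 0) -> Cseries u 0.
Proof.
  intros H. apply (Clim_ext (fun _ => 0)); [ | apply Clim_const].
  intros n. induction n as [ | n IH]; [rewrite Csum_O | rewrite Csum_S, <- IH]; rewrite H; ring.
Qed.

Lemma Cseries_unit_coef (v : nat -> C) : Cseries (fun k => unit_coef k * v k) (v O).
Proof.
  replace (v O) with (unit_coef 0 * v O + 0) by (simpl; ring).
  apply (Cseries_decr_1 (fun k => unit_coef k * v k)), Cseries_0. intros k. simpl. ring.
Qed.

Lemma square_summable_unit_coef : square_summable unit_coef.
Proof.
  exists (Re 1). apply (is_series_ext (V := R_NormedModule) (fun k => Re (unit_coef k * 1))).
  - intros [ | k]; match goal with |- @eq _ ?b ?c => change (@eq R b c) end; cbn [unit_coef].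
    + rewrite Cmod_1. unfold Re; simpl. ring.
    + rewrite Cmod_0. unfold Re; simpl. ring.
  - apply Cseries_Re, (Cseries_unit_coef (fun _ => 1)).
Qed.

Lemma power_series_poly_mul (n : nat) (c f : nat -> C) (p g : C -> C) :
  power_series_on_disk g f -> (forall z, p z = Csum (fun k => c k * z ^ k) n) ->
  power_series_on_disk (fun z => p z * g z - 1) (fun k => poly_mul n c f k - unit_coef k).
Proof.
  intros Hg Hp z Hz. apply is_pseries_Cseries.
  pose proof (proj1 (is_pseries_Cseries _ _ _) (Hg z Hz)) as Sg.
  assert (Sj : forall j, Cseries (fun k => shift j f k * z ^ k) (z ^ j * g z)).
  { induction j as [ | j IH].
    - simpl. rewrite Cmult_1_l. exact Sg.
    - replace (z ^ S j * g z) with (shift (S j) f 0 * z ^ 0 + z * (z ^ j * g z)) by (simpl; ring).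
      apply (Cseries_decr_1 (fun k => shift (S j) f k * z ^ k)).
      apply (Cseries_ext (fun k => z * (shift j f k * z ^ k))); [intros k; simpl; ring | ].
      apply Cseries_scal, IH. }
  assert (Sp : Cseries (fun k => Csum (fun j => c j * (shift j f k * z ^ k)) n) (Csum (fun j => c j * (z ^ j * g z)) n)).
  { apply (Cseries_Csum n (fun j k => c j * (shift j f k * z ^ k))). intros j _. apply Cseries_scal, Sj. }
  pose proof (Cseries_plus _ _ _ _ Sp (Cseries_scal (- 1) _ _ (Cseries_unit_coef (fun k => z ^ k)))) as H.
  replace (p z * g z - 1) with (Csum (fun j => c j * (z ^ j * g z)) n + - 1 * z ^ 0).
  - revert H. apply Cseries_ext. intros k. unfold poly_mul.
    replace (Csum (fun j => c j * (shift j f k * z ^ k)) n) with (z ^ k * Csum (fun j => c j * shift j f k) n).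
    + ring.
    + rewrite <- Csum_mult_l. apply Csum_ext. intros j. ring.
  - replace (Csum (fun j => c j * (z ^ j * g z)) n) with (g z * Csum (fun j => c j * z ^ j) n).
    + rewrite <- Hp. simpl. ring.
    + rewrite <- Csum_mult_l. apply Csum_ext. intros j. ring.
Qed.

(** * Minimality and uniqueness from orthogonality *)

Lemma Csum_conj (u : nat -> C) (n : nat) : Cconj (Csum u n) = Csum (fun k => Cconj (u k)) n.
Proof.
  induction n as [ | n IH]; [now rewrite !Csum_O | ]. now rewrite !Csum_S, Cplus_conj, IH.
Qed.

Lemma Csum_eq_0 (u : nat -> C) (n : nat) : (forall k, (k <= n)%nat -> u k = 0) -> Csum u n = 0.
Proof.
  intros H. induction n as [ | n IH]; [rewrite Csum_O; auto | ].
  rewrite Csum_S, IH, H by auto. ring.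
Qed.

Lemma Csum_single (u : nat -> C) (n k : nat) : (k <= n)%nat ->
  (forall j, (j <= n)%nat -> j <> k -> u j = 0) -> Csum u n = u k.
Proof.
  intros Hk H. induction n as [ | n IH].
  - rewrite Csum_O. f_equal. lia.
  - rewrite Csum_S. destruct (Nat.eq_dec k (S n)) as [-> | Hne].
    + rewrite Csum_eq_0; [ring | ]. intros j Hj. apply H; lia.
    + rewrite IH, (H (S n)) by (auto; lia). ring.
Qed.

Lemma shift_lt (j k : nat) (u : nat -> C) : (k < j)%nat -> shift j u k = 0.
Proof.
  revert k. induction j as [ | j IH]; intros k Hk; [lia | ].
  destruct k as [ | k]; simpl; [reflexivity | apply IH; lia].
Qed.

Lemma shift_diag (j : nat) (u : nat -> C) : shift j u j = u O.
Proof. induction j as [ | j IH]; auto. Qed.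

(** If c_0, ..., c_(k-1) vanish, the k-th coefficient of p f is c_k f_0. *)
Lemma poly_mul_eq_0 (n : nat) (c f : nat -> C) : f O <> 0 ->
  (forall k, poly_mul n c f k = 0) -> forall k, (k <= n)%nat -> c k = 0.
Proof.
  intros Hf H k. induction k as [k IH] using lt_wf_ind. intros Hk.
  specialize (H k). unfold poly_mul in H.
  rewrite (Csum_single _ n k) in H; auto.
  - rewrite shift_diag in H. apply (Cmult_cancel_l (f O)); auto.
    rewrite Cmult_0_r, Cmult_comm. exact H.
  - intros j Hj Hne. destruct (Nat.lt_ge_cases j k) as [Hlt | Hge].
    + rewrite IH by auto. ring.
    + rewrite shift_lt by lia. ring.
Qed.

Lemma Series_eq_0 (u : nat -> R) : (forall k, (0 <= u k)%R) -> ex_series u -> (Series u <= 0)%R ->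
  forall k, u k = 0%R.
Proof.
  intros Hu Hex H0 k. apply Rle_antisym; [ | apply Hu].
  eapply Rle_trans; [ | exact H0].
  apply Rle_trans with (sum_n u k).
  - destruct k as [ | k]; [rewrite sum_O; lra | rewrite sum_Sn].
    assert (0 <= sum_n u k)%R.
    { induction k as [ | k IH]; [rewrite sum_O; auto | rewrite sum_Sn].
      apply Rplus_le_le_0_compat; auto. }
    unfold plus; simpl. lra.
  - apply (is_lim_seq_incr_compare (sum_n u)).
    + exact (Series_correct u Hex).
    + intros m. rewrite sum_Sn. unfold plus; simpl. specialize (Hu (S m)). lra.
Qed.

Lemma Series_nonneg (u : nat -> R) : (forall k, (0 <= u k)%R) -> ex_series u -> (0 <= Series u)%R.
Proof.
  intros Hu Hex. replace 0%R with (Series (fun k => 0 * u k)%R) by (rewrite Series_scal_l; ring).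
  apply Series_le; auto. intros k. specialize (Hu k). lra.
Qed.

Lemma Series_pythagoras (r d : nat -> C) :
  square_summable r -> square_summable d -> Cseries (fun k => r k * Cconj (d k)) 0 ->
  Series (fun k => Cmod (r k + d k) ^ 2)%R =
  (Series (fun k => Cmod (r k) ^ 2) + Series (fun k => Cmod (d k) ^ 2))%R.
Proof.
  intros Hr Hd H. apply Cseries_Re in H. apply is_series_unique.
  pose proof (is_series_plus (V := R_NormedModule) _ _ _ _
    (is_series_plus (V := R_NormedModule) _ _ _ _ (Series_correct _ Hr) (Series_correct _ Hd))
    (is_series_scal_l (V := R_NormedModule) 2%R _ _ H)) as L.
  replace (plus (plus _ _) (scal 2%R (Re 0))) with
    (Series (fun k => Cmod (r k) ^ 2) + Series (fun k => Cmod (d k) ^ 2))%R in L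
    by (unfold plus, scal, Re; simpl; unfold mult; simpl; ring).
  revert L. apply is_series_ext. intros k.
  match goal with |- @eq _ ?b ?c => change (@eq R b c) end.
  unfold plus, scal; simpl. unfold mult; simpl.
  change ((Cmod (r k) ^ 2 + Cmod (d k) ^ 2 + 2 * Re (r k * Cconj (d k)) = Cmod (r k + d k) ^ 2)%R).
  rewrite !Cmod2_alt. unfold Re, Im; simpl. ring.
Qed.

(** For q of degree at most n, (q - p) f is orthogonal to p f - 1, hence |q f - 1|^2 = |p f - 1|^2 +
    |(q - p) f|^2. Equality forces (q - p) f = 0, and f_0 <> 0 then identifies the coefficients of
    q, so q and p agree on the whole plane. *)
Lemma optimal_approximant_of_normal_equations (n : nat) (g p : C -> C) (f c : nat -> C) :
  power_series_on_disk g f -> square_summable f -> f O <> 0 ->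
  (forall z, p z = Csum (fun k => c k * z ^ k) n) ->
  (forall i, (i <= n)%nat ->
     Cseries (fun k => (poly_mul n c f k - unit_coef k) * Cconj (shift i f k)) 0) ->
  optimal_approximant n g p.
Proof.
  intros Hg Hf Hf0 Hp Hort. split; [exists f; split; assumption | ].
  set (r := fun k => poly_mul n c f k - unit_coef k).
  assert (Hr : square_summable r).
  { apply (square_summable_plus (poly_mul n c f) (fun k => - unit_coef k)).
    - apply square_summable_poly_mul, Hf.
    - apply (ex_series_ext (V := R_NormedModule) (fun k => Cmod (unit_coef k) ^ 2)%R);
        [ | apply square_summable_unit_coef].
      intros k. now rewrite Cmod_opp. }
  assert (Hnorm : forall (q : C -> C) (e : nat -> C), (forall z, q z = Csum (fun k => e k * z ^ k) n) ->
    H2_norm (fun z => q z * g z - 1) =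
    sqrt (Series (fun k => Cmod (r k) ^ 2)%R +
          Series (fun k => Cmod (poly_mul n (fun j => (e j - c j)%C) f k) ^ 2)%R)%R).
  { intros q e Hq. rewrite (H2_norm_eq _ _ (power_series_poly_mul n e f q g Hg Hq)). f_equal.
    rewrite <- Series_pythagoras; auto.
    - apply Series_ext. intros k. f_equal. f_equal. unfold r, poly_mul.
      replace (Csum (fun j => e j * shift j f k) n) with
        (Csum (fun j => c j * shift j f k) n + Csum (fun j => (e j - c j) * shift j f k) n); [ring | ].
      rewrite <- Csum_plus. apply Csum_ext. intros j. ring.
    - apply square_summable_poly_mul, Hf.
    - pose proof (Cseries_Csum n (fun i k => Cconj (e i - c i) * (r k * Cconj (shift i f k)))
         (fun i => Cconj (e i - c i) * 0) (fun i Hi => Cseries_scal _ _ _ (Hort i Hi))) as H.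
      rewrite (Csum_eq_0 (fun i => Cconj (e i - c i) * 0)) in H by (intros; ring).
      revert H. apply Cseries_ext. intros k. unfold poly_mul. rewrite Csum_conj, <- Csum_mult_l.
      apply Csum_ext. intros i. rewrite Cmult_conj. ring. }
  assert (Hn0 : H2_norm (fun z => p z * g z - 1) = sqrt (Series (fun k => Cmod (r k) ^ 2)%R)).
  { apply H2_norm_eq, power_series_poly_mul; assumption. }
  assert (Hpos : forall e, (0 <= Series (fun k => Cmod (poly_mul n e f k) ^ 2))%R).
  { intros e. apply Series_nonneg; [intros k; apply pow2_ge_0 | apply square_summable_poly_mul, Hf]. }
  assert (Hrpos : (0 <= Series (fun k => Cmod (r k) ^ 2))%R).
  { apply Series_nonneg; [intros k; apply pow2_ge_0 | exact Hr]. }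
  split.
  - split; [exists c; exact Hp | ]. intros q [e Hq].
    rewrite Hn0, (Hnorm q e Hq). apply sqrt_le_1_alt.
    pose proof (Hpos (fun j => e j - c j)) as H0. cbv beta in H0. lra.
  - intros q [[e Hq] Hmin]. specialize (Hmin p (ex_intro _ c Hp)).
    rewrite Hn0, (Hnorm q e Hq) in Hmin. pose proof (Hpos (fun j => e j - c j)) as H0.
    apply sqrt_le_0 in Hmin; [ | lra | lra].
    assert (Hz : forall k, poly_mul n (fun j => e j - c j) f k = 0).
    { intros k. apply Cmod_eq_0.
      assert (E : (Cmod (poly_mul n (fun j => (e j - c j)%C) f k) ^ 2 = 0)%R).
      { apply (Series_eq_0 (fun k => Cmod (poly_mul n (fun j => (e j - c j)%C) f k) ^ 2)%R).
        - intros i. apply pow2_ge_0.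
        - apply square_summable_poly_mul, Hf.
        - lra. }
      apply Rsqr_0_uniq. rewrite Rsqr_pow2. exact E. }
    apply functional_extensionality. intros z. rewrite Hp.
    transitivity (Csum (fun k => e k * z ^ k) n); [ | symmetry; apply Hq].
    apply Csum_ext_loc. intros k Hk.
    pose proof (poly_mul_eq_0 n (fun j => e j - c j) f Hf0 Hz k Hk) as E.
    replace (e k) with (e k - c k + c k) by ring. cbv beta in E. rewrite E. ring.
Qed.

(** * The normalising constant and the conclusion *)

(** All Gammas reduce to those of a, conj a and a + conj a + 1. The last one comes from B(n + a + 1,
    conj a) and is eliminated by Gauss's sum, which brings in |f|^2; the other two then cancel. *)
Lemma Cbeta_quotient (a : C) (n k : nat) : (0 < Re a)%R -> (k <= n)%nat ->
  Cbinom_rising a k * (Cbeta (INR n + a + 1) (Cconj a) / Cbeta (INR n - INR k + 1) (Cconj a)) =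
  rising a (S n) / (a * Cconj a * rising (a + Cconj a + 1) n *
    Series (fun i => Cmod (pow_coef a i) ^ 2)%R) * opt_coef a n k.
Proof.
  intros Ha Hk. set (b := Cconj a).
  assert (Hb : (0 < Re b)%R) by (unfold b; rewrite re_conj; auto).
  assert (Hab : (0 < Re (a + b + 1))%R) by (unfold Re in *; simpl; lra).
  pose proof (sum_sqr_pow_coef a Ha) as HS. fold b in HS. set (s := RtoC (Series _)) in *.
  rewrite !Cgamma_succ in HS by auto.
  pose proof (Cgamma_neq_0 a Ha) as Na. pose proof (Cgamma_neq_0 b Hb) as Nb.
  pose proof (Cgamma_neq_0 _ Hab) as Nab.
  assert (Za : a <> 0) by (apply Cneq_0_of_Re_pos, Ha).
  assert (Zb : b <> 0) by (apply Cneq_0_of_Re_pos, Hb).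
  assert (Zs : s <> 0) by (intros Z; apply Nab; rewrite <- HS, Z; ring).
  pose proof (rising_neq_0 (a + b + 1) n Hab) as Zr.
  pose proof (rising_neq_0 b (S (n - k)) Hb) as Zrb.
  unfold Cbinom_rising, Cbeta, opt_coef. fold b.
  replace (INR n + a + 1) with (a + INR (S n)) by (rewrite RtoC_S; ring).
  replace (a + INR (S n) + b) with (a + b + 1 + INR n) by (rewrite RtoC_S; ring).
  replace (INR n - INR k + 1) with (INR (n - k) + 1) by (rewrite minus_INR, RtoC_minus by auto; ring).
  replace (INR (n - k) + 1 + b) with (b + INR (S (n - k))) by (rewrite RtoC_S; ring).
  rewrite Cgamma_nat, !Cgamma_plus_nat, <- HS by auto.
  field. repeat split; auto; apply INR_fact_C.
Qed.

Theorem theorem7p1 (a : C) (ha : (0 < Re a)%R) (n : nat) :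
  optimal_approximant n
    (fun z : C => Cpower (1 - z) a)
    (fun z : C =>
       sum_n (fun k : nat =>
         (Cbinom_rising a k *
          (Cbeta (INR n + a + 1) (Cconj a) /
           Cbeta (INR n - INR k + 1) (Cconj a))) * z ^ k) n).
Proof.
  set (s := Series (fun i => Cmod (pow_coef a i) ^ 2)%R).
  set (K := rising a (S n) / (a * Cconj a * rising (a + Cconj a + 1) n * s)).
  assert (Hb : (0 < Re (Cconj a))%R) by (rewrite re_conj; auto).
  (* |f|^2 is nonzero because Gamma(a + conj a + 1) is. *)
  assert (Hs : RtoC s <> 0).
  { intros Z. pose proof (sum_sqr_pow_coef a ha) as E. fold s in E. rewrite Z, Cmult_0_l in E.
    symmetry in E. revert E. apply Cgamma_neq_0. unfold Re in *; simpl in *; lra. }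
  apply (optimal_approximant_of_normal_equations n _ _ (pow_coef a) (fun k => K * opt_coef a n k)).
  - intros z Hz. apply is_pseries_Cseries.
    destruct (pow_series_eq a z ha Hz) as (U & V & HU & HV & E). rewrite E.
    apply Cseries_components; assumption.
  - apply ex_series_pow_coef, ha.
  - intros E. apply RtoC_inj in E. lra.
  - intros z. apply Csum_ext_loc. intros k Hk. f_equal. apply Cbeta_quotient; auto.
  - intros i Hi.
    pose proof (Cseries_Csum n
      (fun j k => K * opt_coef a n j * (shift j (pow_coef a) k * Cconj (shift i (pow_coef a) k)))
      (fun j => K * opt_coef a n j * (s * gram a j i))
      (fun j _ => Cseries_scal _ _ _ (Cseries_gram a j i ha))) as H1.
    pose proof (Cseries_plus _ _ _ _ H1
      (Cseries_scal (- 1) _ _ (Cseries_unit_coef (fun k => Cconj (shift i (pow_coef a) k))))) as H.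
    replace (Csum (fun j => K * opt_coef a n j * (s * gram a j i)) n) with
      (K * s * Csum (fun j => opt_coef a n j * gram a j i) n) in H
      by (rewrite <- Csum_mult_l; apply Csum_ext; intros j; ring).
    replace (RtoC 0) with
      (K * s * Csum (fun j => opt_coef a n j * gram a j i) n + - 1 * Cconj (shift i (pow_coef a) 0)).
    + revert H. apply Cseries_ext. intros k. unfold poly_mul.
      replace ((Csum (fun j => K * opt_coef a n j * shift j (pow_coef a) k) n - unit_coef k) *
        Cconj (shift i (pow_coef a) k)) with
        (Cconj (shift i (pow_coef a) k) * Csum (fun j => K * opt_coef a n j * shift j (pow_coef a) k) n +
         -1 * (unit_coef k * Cconj (shift i (pow_coef a) k))) by ring.
      f_equal. rewrite <- Csum_mult_l. apply Csum_ext. intros j. ring.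
    (* The constant coefficient of z^i f is 1 for i = 0 and 0 otherwise; [K] is chosen to make the
       equation i = 0 exact. *)
    + destruct i as [ | i].
      * rewrite opt_coef_gram_0 by auto. cbn [shift pow_coef]. rewrite Cconj_RtoC. unfold K.
        field. repeat split; auto.
        -- apply (rising_neq_0 a (S n) ha).
        -- apply rising_neq_0. unfold Re in *; simpl in *; lra.
        -- apply Cneq_0_of_Re_pos, Hb.
        -- apply Cneq_0_of_Re_pos, ha.
      * rewrite opt_coef_gram_pos by (auto; lia). cbn [shift]. rewrite Cconj_RtoC. ring.
Qed.
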